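(* Let $N,k\ge1$ be integers, write $z=(x,y)\in\mathbb{R}^{N}\times\mathbb{R}^k$, and let $\Delta_{\mathcal{G}}=\Delta_x+|x|^2\Delta_y$. Let $0\le\gamma<1$, $p>1$, and let $u_0\in C_0(\mathbb{R}^{N+k})$ with $u_0\ge0$, $u_0\not\equiv0$. If $p\gamma\le1$, then the problem $$u_t-\Delta_{\mathcal{G}}u=\int_0^t(t-s)^{-\gamma}|u|^{p-1}u(s)\,ds\ \text{ in }\mathbb{R}^{N+k}\times(0,\infty),\qquad u(z,0)=u_0(z),$$ admits no global nonnegative weak solution $u\in C([0,\infty),C_0(\mathbb{R}^{N+k}))$.
   Context: $C_0(\mathbb{R}^{N+k})$ denotes continuous functions vanishing at infinity. For $T>0$, a function $u$ is a weak solution on $[0,T]$ if $u$, $\int_0^t(t-s)^{-\gamma}|u|^{p-1}u(s)\,ds\in L^1_{\mathrm{loc}}(\mathbb{R}^{N+k}\times(0,T))$ and for every compactly supported $\varphi\in C^{2,1}(\mathbb{R}^{N+k}\times[0,T])$ with $\varphi(\cdot,T)=0$, $$-\int_{\mathbb{R}^{N+k}}u_0\varphi(z,0)\,dz=\int_0^T\!\!\int_{\mathbb{R}^{N+k}}\Big(\int_0^t(t-s)^{-\gamma}|u|^{p-1}u(z,s)\,ds\Big)\varphi\,dz\,dt+\int_0^T\!\!\int_{\mathbb{R}^{N+k}}u\,\Delta_{\mathcal{G}}\varphi\,dz\,dt+\int_0^T\!\!\int_{\mathbb{R}^{N+k}}u\,\varphi_t\,dz\,dt.$$ A global weak solution is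 a weak solution on $[0,T]$ for every $T>0$. *)

(* Defs.v *)
From HB Require Import structures.
From mathcomp Require Import all_boot all_order all_algebra.
From mathcomp Require Import all_classical all_reals all_analysis.
Set Implicit Arguments. Unset Strict Implicit. Unset Printing Implicit Defensive.
Import Order.TTheory GRing.Theory Num.Theory.
Import numFieldNormedType.Exports.
Local Open Scope classical_set_scope.
Local Open Scope ring_scope.

Section Defs.
Variable R : realType.

(* Integral over R^n (points are row vectors 'rV[R]_n), defined as the
   iterated one-dimensional Lebesgue integral (coordinate 0 outermost). *)
Fixpoint rVint (n : nat) : ('rV[R]_n -> R) -> R :=
  match n return ('rV[R]_n -> R) -> R with
  | 0 => fun f => f 0
  | m.+1 => fun f =>
      Rintegral (@lebesgue_measure R) setT
        (fun a : R => rVint (fun t : 'rV[R]_m => f (row_mx (const_mx a : 'rV[R]_1) t)))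
  end.

Definition Rint (a b : R) (f : R -> R) : R :=
  Rintegral (@lebesgue_measure R) `[a, b] f.

Definition pd (n : nat) (i : 'I_n) (f : 'rV[R]_n -> R) (z : 'rV[R]_n) : R :=
  derive f z (delta_mx 0 i).

Definition dt (n : nat) (phi : 'rV[R]_n -> R -> R) (z : 'rV[R]_n) (t : R) : R :=
  derive1 (phi z) t.

Definition C21 (n : nat) (phi : 'rV[R]_n -> R -> R) : Prop :=
  (forall z t, derivable (phi z) t 1) /\
  (forall (i : 'I_n) z t, derivable (fun w => phi w t) z (delta_mx 0 i)) /\
  (forall (i j : 'I_n) z t,
      derivable (fun w => pd i (fun w' => phi w' t) w) z (delta_mx 0 j)) /\
  continuous (fun p : 'rV[R]_n * R => phi p.1 p.2) /\
  continuous (fun p : 'rV[R]_n * R => dt phi p.1 p.2) /\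
  (forall i : 'I_n, continuous (fun p : 'rV[R]_n * R =>
      pd i (fun w => phi w p.2) p.1)) /\
  (forall i j : 'I_n, continuous (fun p : 'rV[R]_n * R =>
      pd j (pd i (fun w => phi w p.2)) p.1)).

Definition test_fun (n : nat) (T : R) (phi : 'rV[R]_n -> R -> R) : Prop :=
  [/\ C21 phi,
      (exists M : R, forall z t, 0 <= t <= T -> M < `|z| -> phi z t = 0) &
      (forall z, phi z T = 0)].

Definition C0 (n : nat) (f : 'rV[R]_n -> R) : Prop :=
  continuous f /\
  (forall e : R, 0 < e -> exists M : R, forall z, M < `|z| -> `|f z| < e).

Definition C_C0 (n : nat) (u : 'rV[R]_n -> R -> R) : Prop :=
  (forall t, 0 <= t -> C0 (fun z => u z t)) /\
  (forall t0 e : R, 0 <= t0 -> 0 < e -> exists d : R, 0 < d /\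
     forall t, 0 <= t -> `|t - t0| < d -> forall z, `|u z t - u z t0| < e).

Definition grushin (N k : nat) (f : 'rV[R]_(N + k) -> R) (z : 'rV[R]_(N + k)) : R :=
  \sum_(i < N) pd (lshift k i) (pd (lshift k i) f) z
  + (\sum_(i < N) (z 0 (lshift k i)) ^+ 2) *
    \sum_(j < k) pd (rshift N j) (pd (rshift N j) f) z.

Definition memory (n : nat) (gamma p : R) (u : 'rV[R]_n -> R -> R)
    (z : 'rV[R]_n) (t : R) : R :=
  Rint 0 t (fun s => powR (t - s) (- gamma) * (powR `|u z s| (p - 1) * u z s)).

Definition weak_sol (N k : nat) (gamma p : R) (u0 : 'rV[R]_(N + k) -> R)
    (u : 'rV[R]_(N + k) -> R -> R) (T : R) : Prop :=
  forall phi, test_fun T phi ->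
    - rVint (fun z => u0 z * phi z 0) =
      Rint 0 T (fun t => rVint (fun z => memory gamma p u z t * phi z t))
    + Rint 0 T (fun t => rVint (fun z => u z t * grushin (fun w => phi w t) z))
    + Rint 0 T (fun t => rVint (fun z => u z t * dt phi z t)).

Definition global_weak_sol (N k : nat) (gamma p : R) (u0 : 'rV[R]_(N + k) -> R)
    (u : 'rV[R]_(N + k) -> R -> R) : Prop :=
  forall T : R, 0 < T -> weak_sol gamma p u0 u T.

End Defs.

(* Main.v *)
(** Test the equation against [psi z * eta t], where [psi] is a product of bumps [(L^2 - s^2)_+^3]
    over the coordinates, so that [Delta_G psi >= - lam psi].  Then [f t = int u(., t) psi] is
    continuously differentiable and, the memory kernel being at least [t^-gamma] on [[0, t]],
    [f' >= - lam f + t^-gamma P] with [P t = int_0^t int u^p psi], while [P' >= c f^p] by convexity.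
    No such pair is global when [p gamma <= 1].  Indeed [f S >= c' S^-gamma] for [S >= 1], so that
    [P' >= c'' / t] and [P] is unbounded.  On the other hand [P] is bounded: with
    [H t = (2 - t / T)^m] and [kappa = (2 T)^-gamma], the function [- f H' + kappa P H] vanishes at
    [2 T], and Young's inequality bounds its derivative from below by [- C T^(-1 - gamma)] on
    [[T, 2 T]], whence [P T <= C']. *)

Require Import Defs.
From HB Require Import structures.
From mathcomp Require Import all_boot all_order all_algebra.
From mathcomp Require Import all_classical all_reals all_analysis.
From mathcomp Require Import measurable_realfun ring lra.
Import Order.TTheory GRing.Theory Num.Theory.
Import numFieldNormedType.Exports.
Local Open Scope ring_scope.
Local Open Scope classical_set_scope.

Set Implicit Arguments.
Unset Strict Implicit.
Unset Printing Implicit Defensive.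

(** * One-variable calculus *)

(** The cutoff [psi] stays fixed while the time horizon grows, so the dimension never enters the
    exponents; the price is the damping [- lam f], which alone would allow exponential decay. The
    memory defeats it: [P] does not decrease, so the source [t^-gamma P] decays at most
    polynomially, and [f] cannot fall faster than its source. The condition [p gamma <= 1] is used
    twice in the same way: [(S^-gamma)^p >= 1/S] makes the lower bound of [P'] non-integrable, and
    [T^(-p gamma) >= 1/T] lets the term in [f^p], weighted by [T^-gamma], absorb linear terms of
    size [f / T]. The term [kappa P H] is there for a cancellation: on [[T, 2 T]] the source is at
    least [kappa P], so it adds at least [- kappa P H'] to the derivative of [- f H'], which offsets
    the term [kappa P H']. The exponent [m] must be large enough for [H''] to be dominated by
    [H^(1/p)]. Space and time integrals are never exchanged: the kernel is estimated pointwise in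
    space, and [P] is differentiated under the space integral. *)

Section RealCalculus.
Variable R : realType.
Implicit Types (f g : R -> R) (x a b : R).

Lemma is_deriveP1 f x df :
  derivable f x 1 -> derive1 f x = df -> is_derive x 1 f df.
Proof. by move=> df1 <-; rewrite derive1E; exact: derivableP. Qed.

Lemma is_derive_continuous f x df : is_derive x 1 f df -> {for x, continuous f}.
Proof.
by move=> [d _]; apply: differentiable_continuous; apply/derivable1_diffP.
Qed.

Lemma is_derive_add f g x df dg : is_derive x 1 f df -> is_derive x 1 g dg ->
  is_derive x 1 (fun y => f y + g y) (df + dg).
Proof. by move=> *; exact: is_deriveD. Qed.

Lemma is_derive_opp f x df : is_derive x 1 f df -> is_derive x 1 (fun y => - f y) (- df).
Proof. by move=> *; exact: is_deriveN. Qed.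

Lemma is_derive_mul f g x df dg : is_derive x 1 f df -> is_derive x 1 g dg ->
  is_derive x 1 (fun y => f y * g y) (df * g x + f x * dg).
Proof.
move=> hf hg; have := is_deriveM hf hg.
rewrite (_ : f * g = fun y => f y * g y)//.
by move/is_derive_eq; apply; rewrite addrC [LHS]/= /GRing.scale/= mulrC.
Qed.

Lemma is_derive_const x (c : R) : is_derive x 1 (fun=> c) 0.
Proof. exact: is_derive_cst. Qed.

Lemma is_derive_var x : is_derive x 1 (fun y => y) (1 : R).
Proof. exact: is_derive_id. Qed.

Lemma is_derive_scale f x df (c : R) :
  is_derive x 1 f df -> is_derive x 1 (fun y => c * f y) (c * df).
Proof.
move=> hf; apply: is_derive_eq (is_derive_mul (is_derive_const x c) hf) _.
by rewrite mul0r add0r.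
Qed.

Lemma is_derive_chain f g x df dg : is_derive (g x) 1 f df ->
  is_derive x 1 g dg -> is_derive x 1 (fun y => f (g y)) (df * dg).
Proof. exact: is_derive1_comp. Qed.

Lemma is_derive_pow f x df n : is_derive x 1 f df ->
  is_derive x 1 (fun y => f y ^+ n) (n%:R * f x ^+ n.-1 * df).
Proof.
move=> hf; have := is_deriveX n hf; rewrite (_ : f ^+ n = fun y => f y ^+ n) //.
by apply/funext => y; elim: n => [|n IH]; rewrite ?expr0// !exprS -IH.
Qed.

Lemma derive_ge0_le f (df : R -> R) a b : a <= b ->
  (forall x, a < x < b -> is_derive x 1 f (df x)) ->
  (forall x, a < x < b -> 0 <= df x) ->
  {within `[a, b], continuous f} -> f a <= f b.
Proof.
move=> ab hd h0 cf.
apply: (@ger0_derive1_le_cc _ f a b) => //; rewrite ?in_itv/= ?lexx ?ab// => x.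
- by rewrite in_itv/= => /hd[].
- by rewrite in_itv/= => hx; rewrite derive1E; have [_ ->] := hd x hx; exact: h0.
Qed.

Lemma continuous_within_itv f a b : (forall x, a <= x <= b -> {for x, continuous f}) ->
  {within `[a, b], continuous f}.
Proof.
move=> cf; apply/continuous_in_subspaceT => x; rewrite inE/= in_itv/=; exact: cf.
Qed.

Lemma integrable_itv f a b : {within `[a, b], continuous f} ->
  (@lebesgue_measure R).-integrable `[a, b] (EFin \o f).
Proof. by move=> cf; apply: continuous_compact_integrable => //; exact: segment_compact. Qed.

Lemma Rint_FTC2 (F f : R -> R) a b : a <= b ->
  (forall x, is_derive x 1 F (f x)) -> continuous f -> Defs.Rint a b f = F b - F a.
Proof.
rewrite le_eqVlt => /predU1P[<-|ab] dF cf.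
  by rewrite /Defs.Rint set_itv1 Rintegral_set1 subrr.
rewrite /Defs.Rint /Rintegral (@continuous_FTC2 _ f F a b)//.
- exact: continuous_subspaceT.
- split=> [x _||].
  + by have [] := dF x.
  + by apply: cvg_at_right_filter; exact: is_derive_continuous (dF a).
  + by apply: cvg_at_left_filter; exact: is_derive_continuous (dF b).
- by move=> x _; rewrite derive1E; have [_ ->] := dF x.
Qed.

Lemma continuous_max0 : continuous (fun t : R => Num.max t 0).
Proof.
move=> t; apply: (@continuous_max _ _ (fun x : R => x) (fun=> 0)).
  exact: cvg_id.
exact: cvg_cst.
Qed.

(** Only nonnegative times carry data, yet a derivative at 0 needs both sides; hence the integrand
    is frozen at [f 0] for negative times. After subtracting [f 0] it vanishes there, so its
    integral from minus infinity is finite and differentiable everywhere; the linear term [t * f 0]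
    restores what was subtracted. *)
Lemma primitive f : continuous f ->
  exists2 F : R -> R, F 0 = 0 & forall t : R, is_derive t 1 F (f (Num.max t 0)).
Proof.
move=> cf.
pose g (t : R) := f (Num.max t 0) - f 0.
have cg : continuous g.
  move=> t; apply: cvgB; last exact: cvg_cst.
  by apply: continuous_comp; [exact: continuous_max0|exact: cf].
have g0 t : t <= 0 -> g t = 0 by move=> t0; rewrite /g max_r// subrr.
pose G (t : R) := Rintegral (@lebesgue_measure R) `]-oo, t] g.
have iG u : (@lebesgue_measure R).-integrable `]-oo, u] (EFin \o g).
  have h := integrable_itv (@continuous_subspaceT _ _ `[0, Num.max u 0] _ cg).
  have h1 : (@lebesgue_measure R).-integrable setT (EFin \o (g \_ `[0, Num.max u 0])).
    by rewrite -restrict_EFin; apply/integrable_restrict => //=; rewrite setTI.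
  have h2 : (@lebesgue_measure R).-integrable `]-oo, u]
      (EFin \o (g \_ `[0, Num.max u 0])).
    exact: integrableS h1.
  apply: eq_integrable h2 => //= x; rewrite inE/= in_itv/= => xu; congr EFin.
  rewrite patchE; case: ifPn => //; rewrite notin_setE/= in_itv/= => /negP.
  rewrite negb_and -!ltNge gt_max => /orP[/ltW/g0//|/andP[]].
  by rewrite ltNge xu.
have dG (t : R) : is_derive t 1 G (g t).
  have tt1 : t < t + 1 by rewrite ltrDl.
  have [|d1 d2] := @continuous_FTC1 _ g -oo%O t (t + 1) tt1 (iG _) _ (cg t).
    by rewrite ltNyr.
  exact: is_deriveP1.
have G0 : G 0 = 0.
  rewrite /G (@eq_Rintegral _ _ _ _ _ (fun=> 0)); last first.
    by move=> x; rewrite inE/= in_itv/= => /g0.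
  by rewrite /Rintegral/= integral0.
exists (fun t => t * f 0 + G t); first by rewrite mul0r G0 addr0.
move=> t; apply: is_derive_eq (is_derive_add (is_derive_mul (is_derive_var t)
  (is_derive_const t (f 0))) (dG t)) _.
by rewrite /g; ring.
Qed.

End RealCalculus.

(** * The differential inequality *)

Section Blowup.
Variable R : realType.
Implicit Types (f P : R -> R).

Lemma is_derive_within f (df : R -> R) (a b : R) :
  (forall x : R, a <= x <= b -> is_derive x 1 f (df x)) -> {within `[a, b], continuous f}.
Proof. by move=> hd; apply: continuous_within_itv => x /hd; exact: is_derive_continuous. Qed.

(** The derivative of [expR (lam * x) * (f x - k)] is [expR (lam * x) * (lam * (f x - k) + df x)].
    Taking [k = 0] gives positivity, a positive [k] a comparison with a constant source level. The
    endpoints ask only for continuity, which is all that [no_global_ode] assumes of [f] at 0. *)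
Lemma gronwall_ge f (df : R -> R) (lam k a b : R) : a <= b ->
  (forall x : R, a < x < b -> is_derive x 1 f (df x)) ->
  (forall x, a <= x <= b -> {for x, continuous f}) ->
  (forall x, a < x < b -> - lam * (f x - k) <= df x) ->
  expR (lam * a) * (f a - k) <= expR (lam * b) * (f b - k).
Proof.
move=> ab hd cf hle.
have dE (x : R) : is_derive x 1 (fun t => expR (lam * t)) (expR (lam * x) * lam).
  have h := is_derive_scale lam (is_derive_var x); rewrite mulr1 in h.
  exact: (is_derive_chain (is_derive_expR (lam * x)) h).
apply: (@derive_ge0_le _ (fun t => expR (lam * t) * (f t - k))
  (fun x => expR (lam * x) * lam * (f x - k) + expR (lam * x) * df x)) => //.
- move=> x xab; apply: is_derive_mul (dE x) _.
  apply: is_derive_eq (is_derive_add (hd x xab) (is_derive_const x (- k))) _.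
  exact: addr0.
- move=> x xab; rewrite -mulrA -mulrDr mulr_ge0 ?expR_ge0//.
  by rewrite -lerBlDl sub0r -mulNr; exact: hle.
- apply: continuous_within_itv => x xab; apply: continuousM; first exact: is_derive_continuous (dE x).
  by apply: continuousB; [exact: cf|exact: cst_continuous].
Qed.

Lemma powRN_le (x y r : R) : 0 < x -> x <= y -> 0 <= r -> y `^ (- r) <= x `^ (- r).
Proof.
move=> x0 xy r0; have y0 := lt_le_trans x0 xy.
by rewrite !powRN lef_pV2 ?posrE ?powR_gt0// ge0_ler_powR ?nnegrE ?(ltW x0) ?(ltW y0).
Qed.

(* The loss is the value of the linear term at the point where both terms balance when
   [p * gamma = 1]. *)
Lemma young_pointwise (a b gamma p T y : R) : 0 < a -> 0 < b -> 0 <= gamma -> 1 < p ->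
  p * gamma <= 1 -> 1 <= T -> 0 <= y ->
  - (a / T * ((a / b) `^ (p - 1)^-1 * T `^ (- gamma))) <=
  - (a / T * y) + b * T `^ (- gamma) * y `^ p.
Proof.
move=> a0 b0 g0 p1 pg T1 y0; set y1 := _ `^ _ * _.
have T0 : 0 < T by lra.
have aT : 0 < a / T by rewrite divr_gt0.
have y1_0 : 0 <= y1 by rewrite mulr_ge0 ?powR_ge0.
(* Below the balance point [y1] the linear term alone is within the loss; above it the power absorbs
   the linear term and the right side is nonnegative. *)
have [yy1|y1y] := leP y y1.
  apply: (@le_trans _ _ (- (a / T * y))); first by rewrite lerN2 ler_pM2l.
  by rewrite lerDl !mulr_ge0 ?powR_ge0// ltW.
apply: (@le_trans _ _ 0); first by rewrite oppr_le0 mulr_ge0// ltW.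
rewrite addrC subr_ge0.
have yp : y1 `^ (p - 1) <= y `^ (p - 1) by rewrite ge0_ler_powR ?nnegrE//; lra.
rewrite -[y `^ p](@mulr_powRB1 _ y p)//; last lra.
apply: (@le_trans _ _ (b * T `^ (- gamma) * (y * y1 `^ (p - 1)))); last first.
  by rewrite ler_pM2l ?mulr_gt0 ?powR_gt0// ler_wpM2l.
rewrite /y1 powRM ?powR_ge0// -!powRrM mulVf ?gt_eqF//; last lra.
rewrite powRr1; last by rewrite ltW// divr_gt0.
rewrite (_ : b * _ * _ = a * y * (T `^ (- gamma) * T `^ (- gamma * (p - 1)))); last first.
  by field; rewrite gt_eqF.
rewrite -powRD; last by apply/implyP => _; rewrite gt_eqF.
rewrite mulrAC ler_wpM2l ?mulr_ge0//; first exact: ltW.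
(* The exponents of [T] add up to [- (p * gamma) >= -1], and [1 <= T]. *)
by rewrite -(powR_inv1 (ltW T0)) ler_powR//; lra.
Qed.

Lemma no_global_ode (lam c gamma p : R) f P (df dP : R -> R) :
  0 < lam -> 0 < c -> 0 <= gamma -> 1 < p -> p * gamma <= 1 ->
  {for 0, continuous f} -> 0 < f 0 -> (forall t, 0 <= t -> 0 <= P t) ->
  (forall t : R, 0 < t -> is_derive t 1 f (df t)) ->
  (forall t : R, 0 < t -> is_derive t 1 P (dP t)) ->
  (forall t, 0 < t -> - lam * f t + t `^ (- gamma) * P t <= df t) ->
  (forall t, 0 < t -> c * f t `^ p <= dP t) -> False.
Proof.
move=> lam0 c0 g0 p1 pg cf0 f0 P0 hf hP ef eP.
have p0 : 0 < p by lra.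
have fpos t : 0 <= t -> 0 < f t.
  move=> t0; have := @gronwall_ge f df lam 0 0 t t0; rewrite !subr0 mulr0 expR0 mul1r => h.
  have : 0 < expR (lam * t) * f t.
    apply: lt_le_trans f0 _; apply: h.
    - by move=> x /andP[x0 _]; exact: hf.
    - move=> x /andP[]; rewrite le_eqVlt => /predU1P[<-//|x0 _].
      exact: is_derive_continuous (hf x x0).
    - move=> x /andP[x0 _]; rewrite subr0; apply: le_trans (ef x x0).
      by rewrite lerDl mulr_ge0 ?powR_ge0// P0// ltW.
  by rewrite pmulr_rgt0// expR_gt0.
have dP0 t : 0 < t -> 0 < dP t.
  move=> t0; apply: lt_le_trans (eP t t0); rewrite mulr_gt0// powR_gt0//.
  by rewrite fpos// ltW.
have Pmono s t : 0 < s -> s <= t -> P s <= P t.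
  move=> s0 st; apply: (@derive_ge0_le _ P dP) => //.
  - by move=> x /andP[sx _]; apply: hP; rewrite (lt_trans s0).
  - by move=> x /andP[sx _]; apply/ltW/dP0; rewrite (lt_trans s0).
  - by apply: (@is_derive_within _ dP) => x /andP[sx _]; apply: hP; rewrite (lt_le_trans s0).
(* [P] is nonnegative at 1/2 and strictly increasing from there on; starting at 1/2 avoids time 0,
   where [P] is not assumed continuous. *)
have P1 : 0 < P 1.
  apply: (@le_lt_trans _ _ (P 2^-1)); first by apply: P0; lra.
  apply: (@gtr0_derive1_lt_cc _ P 2^-1 1); rewrite ?in_itv/=; try lra.
  - by move=> x; rewrite in_itv/= => /andP[hx _]; have [] // := hP x _; lra.
  - move=> x; rewrite in_itv/= => /andP[hx _]; rewrite derive1E.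
    have x0 : 0 < x by lra.
    by have [_ ->] := hP x x0; exact: dP0.
  - by apply: (@is_derive_within _ dP) => x /andP[sx _]; apply: hP; lra.
(* The bound by [f 1] makes [f 1 - k] nonnegative below; the bound by [P 1 / lam] makes the source
   at least [lam * k]. *)
pose c1 := Num.min (f 1) (P 1 / lam).
have c1_0 : 0 < c1 by rewrite lt_min fpos// divr_gt0.
(* On [[1, S]] the source is at least [S^-gamma P 1 >= lam k], so [f' >= - lam (f - k)] with [k]
   constant in time, though dependent on [S]. *)
have flow S : 1 <= S -> c1 * S `^ (- gamma) <= f S.
  move=> S1; have S0 : 0 < S by lra.
  set k := c1 * _.
  have kc1 : k <= c1.
    rewrite ler_piMr ?(ltW c1_0)// -[leRHS](powRr0 S) ler_powR//; lra.
  have := @gronwall_ge f df lam k 1 S S1 => h.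
  have {h} : expR (lam * 1) * (f 1 - k) <= expR (lam * S) * (f S - k).
    apply: h.
    - by move=> x /andP[x1 _]; apply: hf; lra.
    - by move=> x /andP[x1 _]; apply: is_derive_continuous (hf x _); lra.
    - move=> x /andP[x1 xS]; have x0 : 0 < x by lra.
      apply: le_trans (ef x x0); rewrite (_ : - lam * (f x - k) = - lam * f x + lam * k); last ring.
      rewrite lerD2l.
      have h1 : lam * c1 <= P x.
        apply: (@le_trans _ _ (P 1)); last by apply: Pmono => //; lra.
        by rewrite mulrC -ler_pdivlMr// ge_min lexx orbT.
      rewrite mulrA mulrC ler_pM ?powR_ge0//; last by rewrite powRN_le// ltW.
      by rewrite mulr_ge0 ?ltW.
  have h2 : 0 <= expR (lam * 1) * (f 1 - k).
    by rewrite mulr_ge0 ?expR_ge0// subr_ge0 (le_trans kc1)// ge_min lexx.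
  by move/(le_trans h2); rewrite pmulr_rge0 ?expR_gt0// subr_ge0.
pose c2 := c * c1 `^ p.
have c2_0 : 0 < c2 by rewrite mulr_gt0// powR_gt0.
have Plog T : 1 <= T -> c2 * ln T <= P T.
  move=> T1.
  have hd (x : R) : 1 <= x -> is_derive x 1 (fun t => P t + - (c2 * ln t)) (dP x - c2 * x^-1).
    move=> x1; have x0 : 0 < x by lra.
    apply: is_derive_add (hP x x0) _.
    exact: is_derive_opp (is_derive_scale c2 (is_derive1_ln x0)).
  have : P 1 + - (c2 * ln 1) <= P T + - (c2 * ln T).
    apply: (@derive_ge0_le _ (fun t => P t + - (c2 * ln t)) (fun x => dP x - c2 * x^-1)) => //.
    - by move=> x /andP[x1 _]; exact/hd/ltW.
    - move=> x /andP[x1 _]; have x0 : 0 < x by lra.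
      rewrite subr_ge0; apply: le_trans (eP x x0).
      rewrite -mulrA ler_pM2l//.
      apply: (@le_trans _ _ ((c1 * x `^ (- gamma)) `^ p)); last first.
        rewrite ge0_ler_powR ?nnegrE ?mulr_ge0 ?powR_ge0 ?(ltW c1_0) ?(ltW p0)//.
          by rewrite ltW// fpos// ltW.
        by apply: flow; exact: ltW.
      rewrite powRM ?powR_ge0 ?(ltW c1_0)// ler_pM2l ?powR_gt0//.
      rewrite -powRrM -(powR_inv1 (ltW x0)) ler_powR//; last lra.
      exact: ltW.
    - apply: (@is_derive_within _ (fun x => dP x - c2 * x^-1)) => x /andP[x1 _]; exact: hd.
  by rewrite ln1 mulr0 oppr0 addr0; move: P1; lra.
(* Equivalent to [(n + 2) / p < n]: for [0 < X <= 1], the factor [X ^+ n] from the second derivative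
   of the weight then lies below the [p]-th root of the weight [X ^+ n.+2]. *)
have [n hn] : exists n : nat, 2 < n%:R * (p - 1).
  exists (Num.bound (2 / (p - 1))); rewrite -ltr_pdivrMr; last lra.
  by rewrite archi_boundP// divr_ge0//; lra.
(* [a / T * X ^+ n] will dominate [lam * eta - deta]; [b] satisfies [b T^-gamma = c (2 T)^-gamma];
   [C] is the total loss over an interval of length [T], divided by [(2 T)^-gamma]. *)
pose a := (lam + 1) * (n.+2)%:R ^+ 2.
pose b := c * 2 `^ (- gamma).
have a0 : 0 < a by rewrite mulr_gt0 ?exprn_gt0// ?ltr0n//; lra.
have b0 : 0 < b by rewrite mulr_gt0// powR_gt0.
pose C := a * (a / b) `^ (p - 1)^-1 / 2 `^ (- gamma).
have Pbnd T : 1 <= T -> P T <= C.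
  move=> T1; have T0 : 0 < T by lra.
  pose X (t : R) := 2 + - (T^-1 * t).
  pose kap := (2 * T) `^ (- gamma).
  have kap0 : 0 < kap by rewrite powR_gt0// mulr_gt0.
  have kapE : c * kap = b * T `^ (- gamma) by rewrite /kap powRM ?(ltW T0)// mulrA.
  (* Minus the derivative of the weight [X ^+ n.+2]. *)
  pose eta t := (n.+2)%:R * T^-1 * X t ^+ n.+1.
  pose Phi t := f t * eta t + kap * (P t * X t ^+ n.+2).
  pose K := a / T * ((a / b) `^ (p - 1)^-1 * T `^ (- gamma)).
  have dX (t : R) : is_derive t 1 X (- T^-1).
    apply: is_derive_eq (is_derive_add (is_derive_const t 2)
      (is_derive_opp (is_derive_scale T^-1 (is_derive_var t)))) _.
    by rewrite add0r mulr1.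
  pose deta t := (n.+2)%:R * T^-1 * (n.+1%:R * X t ^+ n * - T^-1).
  have heta (t : R) : is_derive t 1 eta (deta t).
    exact: is_derive_scale (is_derive_pow n.+1 (dX t)).
  pose dPhi t := df t * eta t + f t * deta t +
    kap * (dP t * X t ^+ n.+2 + P t * (n.+2%:R * X t ^+ n.+1 * - T^-1)).
  have hPhi (t : R) : 0 < t -> is_derive t 1 Phi (dPhi t).
    move=> t0; apply: is_derive_add (is_derive_mul (hf t t0) (heta t)) _.
    apply: is_derive_scale; apply: is_derive_mul (hP t t0) _.
    exact: is_derive_pow n.+2 (dX t).
  have hKPhi (t : R) : 0 < t -> is_derive t 1 (fun s => Phi s + K * s) (dPhi t + K).
    move=> t0; apply: is_derive_add (hPhi t t0) _.
    by apply: is_derive_eq (is_derive_scale K (is_derive_var t)) _; rewrite mulr1.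
  have dPhi_ge t : T < t < 2 * T -> 0 <= dPhi t + K.
    move=> /andP[Tt t2T]; have t0 : 0 < t by lra.
    have x0 : 0 < X t by rewrite /X subr_gt0 mulrC ltr_pdivrMr.
    have x1 : X t < 1.
      suff : 1 < T^-1 * t by rewrite /X; lra.
      by rewrite mulrC ltr_pdivlMr// mul1r.
    have ft := fpos t (ltW t0).
    pose Y := X t `^ (n.+2%:R / p).
    have hY : X t ^+ n <= Y.
      rewrite -(powR_mulrn n (ltW x0)); apply: ger_powR; first by rewrite x0 ltW.
      by rewrite ler_pdivrMr// -addn2 natrD; lra.
    have Yp : (f t * Y) `^ p = f t `^ p * X t ^+ n.+2.
      rewrite powRM ?powR_ge0 ?(ltW ft)// -powRrM divfK ?gt_eqF//.
      by rewrite powR_mulrn// ltW.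
    have Y0 : 0 <= Y by exact: powR_ge0.
    have yo := young_pointwise a0 b0 g0 p1 pg T1 (mulr_ge0 (ltW ft) Y0).
    have eta0 : 0 <= eta t.
      by rewrite !mulr_ge0// ?invr_ge0 ?(ltW T0)// exprn_ge0// ltW.
    (* Since [t <= 2 T], the kernel factor is at least [kap]; the term [kap * P t * eta t] gained
       here is exactly what [e5] takes away. *)
    have e1 : (- lam * f t + kap * P t) * eta t <= df t * eta t.
      apply: ler_wpM2r => //; apply: le_trans (ef t t0); rewrite lerD2l.
      by apply: ler_wpM2r; [apply/P0/ltW|apply: powRN_le => //; exact: ltW].
    have e2 : kap * (c * f t `^ p * X t ^+ n.+2) <= kap * (dP t * X t ^+ n.+2).
      rewrite ler_pM2l// ler_wpM2r//; last exact: eP.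
      by rewrite exprn_ge0// ltW.
    have e3 : lam * eta t - deta t <= a / T * Y.
      apply: (@le_trans _ _ (a / T * X t ^+ n)); last first.
        by rewrite ler_pM2l// divr_gt0.
      rewrite /eta /deta exprS.
      rewrite (_ : _ - _ = n.+2%:R / T * X t ^+ n * (lam * X t + n.+1%:R / T)); last ring.
      rewrite (_ : a / T * X t ^+ n = n.+2%:R / T * X t ^+ n * ((lam + 1) * n.+2%:R)); last first.
        by rewrite /a; ring.
      apply: ler_wpM2l; first by rewrite !mulr_ge0// ?invr_ge0 ?(ltW T0)// exprn_ge0// ltW.
      have l1 : lam * X t <= lam by rewrite ler_piMr ?ltW.
      have l2 : n.+1%:R / T <= n.+1%:R by rewrite ler_pdivrMr// ler_peMr.
      have l3 : n.+2%:R = n.+1%:R + 1 :> R by rewrite -natr1.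
      have l4 : 0 <= n%:R :> R by [].
      have l5 : n.+1%:R = n%:R + 1 :> R by rewrite -natr1.
      have l6 : 0 <= lam * (n.+1%:R : R) by rewrite mulr_ge0// ltW.
      rewrite l3; lra.
    have e4 : f t * (lam * eta t - deta t) <= f t * (a / T * Y) by rewrite ler_pM2l.
    have e5 : kap * (P t * (n.+2%:R * X t ^+ n.+1 * - T^-1)) = - (kap * P t * eta t).
      by rewrite /eta; ring.
    have e6 : kap * (c * f t `^ p * X t ^+ n.+2) = b * T `^ (- gamma) * (f t * Y) `^ p.
      by rewrite Yp -kapE; ring.
    rewrite /dPhi mulrDr e5; move: yo e1 e2 e4; rewrite -/K -e6.
    move: (kap * (c * _ * _)) (kap * (dP t * _)) (deta t) => v1 v2 v3.
    move: (eta t) (a / T) => v4 v5; lra.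
  (* Adding [K * s] compensates the Young loss and makes the sum nondecreasing; [Phi] vanishes at
     [2 T] because [X] does. *)
  have : Phi T + K * T <= Phi (2 * T) + K * (2 * T).
    apply: (@derive_ge0_le _ (fun s => Phi s + K * s) (fun t => dPhi t + K)).
    - lra.
    - by move=> x /andP[x1 _]; apply: hKPhi; lra.
    - exact: dPhi_ge.
    - by apply: (@is_derive_within _ (fun t => dPhi t + K)) => x /andP[x1 _]; apply: hKPhi; lra.
  have X2T : X (2 * T) = 0 by rewrite /X mulrCA mulVf ?gt_eqF// mulr1 subrr.
  have XT : X T = 1 by rewrite /X mulVf ?gt_eqF//; lra.
  rewrite /Phi /eta X2T XT !expr0n/= !expr1n !mulr0 !mulr1 addr0 add0r => h.
  have h1 : 0 <= f T * (n.+2%:R / T).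
    by rewrite mulr_ge0 ?divr_ge0 ?(ltW T0)// ltW// fpos// ltW.
  have h2 : kap * P T <= K * T by lra.
  have KT : K * T = kap * C.
    rewrite /K /kap /C (@powRM _ 2 T) ?(ltW T0)//.
    have : 2 `^ (- gamma) != 0 :> R by rewrite gt_eqF// powR_gt0.
    move: (2 `^ _) (T `^ _) ((a / b) `^ _) => v1 v2 v3 v10; field.
    by rewrite v10 gt_eqF.
  by move: h2; rewrite KT ler_pM2l.
pose T := expR ((`|C| + 1) / c2).
have T1 : 1 <= T by rewrite -expR0 ler_expR divr_ge0// ?addr_ge0// ltW.
have := Plog T T1; rewrite expRK mulrC divfK ?gt_eqF// => h1.
have := Pbnd T T1; have := ler_norm C; lra.
Qed.


End Blowup.

(** * Real powers and the singular kernel *)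

Section PowerFunctions.
Variable R : realType.

(** The absolute value keeps the base away from negative numbers, where [powR] takes a default value
    that would break continuity at 0. *)
Lemma continuous_norm_powR (r : R) : 0 < r -> continuous (fun x : R => `|x| `^ r).
Proof.
move=> r0 x; have [->|x0] := eqVneq x 0; last first.
  apply: (@continuous_comp _ _ _ (fun y : R => `|y|) (fun y => y `^ r)).
    exact: norm_continuous.
  by apply: is_derive_continuous (is_derive1_powR r _); rewrite normr_gt0.
apply/cvgrPdist_lt => e e0; near=> y.
rewrite normr0 powR0 ?gt_eqF// sub0r normrN norm_powR ?normr_ge0// normr_id.
rewrite -[ltRHS](@powRr1 _ e) ?(ltW e0)// -(mulVf (lt0r_neq0 r0)) powRrM.
apply: gt0_ltr_powR; rewrite ?nnegrE ?powR_ge0 ?normr_ge0//.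
near: y. by apply: (@nbhs0_lt _ R^o); rewrite powR_gt0.
Unshelve. all: by end_near. Qed.

(* Young's inequality, read as: the graph of [x `^ p] lies above its tangent at [a]. *)
Lemma powR_tangent (p a x : R) : 1 < p -> 0 <= a -> 0 <= x ->
  p * a `^ (p - 1) * x - (p - 1) * a `^ p <= x `^ p.
Proof.
move=> p1 a0 x0; have p0 : 0 < p by lra.
have q0 : 0 < p / (p - 1) by rewrite divr_gt0//; lra.
have := @conjugate_powR _ x (a `^ (p - 1)) p (p / (p - 1)) x0 (powR_ge0 _ _) p0 q0.
rewrite -powRrM mulrCA mulfV ?mulr1; last by rewrite gt_eqF//; lra.
have -> : p^-1 + (p / (p - 1))^-1 = 1 by field; rewrite !gt_eqF//; lra.
move=> /(_ erefl); rewrite -(ler_pM2l p0).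
have -> : p * (x `^ p / p + a `^ p / (p / (p - 1))) = x `^ p + (p - 1) * a `^ p.
  by field; rewrite !gt_eqF//; lra.
lra.
Qed.

Lemma kernel_measurable (g t : R) (A : set R) :
  measurable_fun A (fun s : R => (t - s) `^ (- g)).
Proof.
apply: measurable_funTS; apply: (@measurableT_comp _ _ _ _ _ _ (@powR R ^~ (- g))) => //.
apply: continuous_measurable_fun => x; apply: cvgB; [exact: cvg_cst|exact: cvg_id].
Qed.

(** The kernel may blow up at [s = t], so the fundamental theorem is applied on [[a, t - h n]] with
    [h n] tending to 0, and monotone convergence passes to [[a, t[]. The primitive tends to 0 at [t]
    because [0 < 1 - g]. *)
Lemma kernel_integral (g a t : R) : 0 <= g -> g < 1 -> a <= t ->
  (@lebesgue_measure R).-integrable `[a, t] (EFin \o (fun s => (t - s) `^ (- g))) /\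
  Defs.Rint a t (fun s => (t - s) `^ (- g)) = (t - a) `^ (1 - g) / (1 - g).
Proof.
move=> g0 g1; have h0 : 0 < 1 - g by lra.
have h0' : 1 - g != 0 by rewrite gt_eqF.
rewrite le_eqVlt => /predU1P[<-|at_].
  rewrite /Defs.Rint set_itv1 Rintegral_set1 subrr powR0// mul0r; split=> //.
  apply/integrableP; split. apply/measurable_EFinP. exact: kernel_measurable.
  by rewrite integral_set1.
pose f (s : R) := (t - s) `^ (- g).
pose F (s : R) := - ((t - s) `^ (1 - g) / (1 - g)).
have dF (s : R) : s < t -> is_derive s 1 F (f s).
  move=> st; have ts : 0 < t - s by rewrite subr_gt0.
  have h1 : is_derive s 1 (fun s => t - s) (-1).
    by apply: is_derive_eq (is_derive_add (is_derive_const s t)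
      (is_derive_opp (is_derive_var s))) _; rewrite add0r.
  have h2 := @is_derive_chain R (fun y => y `^ (1 - g)) (fun s => t - s) s _ _ (is_derive1_powR (1 - g) ts) h1.
  apply: is_derive_eq (is_derive_opp (is_derive_mul h2 (is_derive_const s (1 - g)^-1))) _.
  rewrite mulr0 addr0 /f (_ : 1 - g - 1 = - g); last ring.
  by field.
(* With [n.+2] even the first interval [[a, t - h 0]] is nondegenerate, as the fundamental theorem
   requires. *)
pose h n : R := (t - a) * n.+2%:R^-1.
have hpos n : 0 < h n by rewrite mulr_gt0 ?invr_gt0// subr_gt0.
have hle n : h n < t - a.
  by rewrite /h ltr_pdivrMr// ltr_pMr ?subr_gt0// ltr1n.
pose E n : set R := `[a, t - h n].
have Eint n : (\int[lebesgue_measure]_(s in E n) (f s)%:E = (F (t - h n))%:E - (F a)%:E)%E.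
  have an : a < t - h n by move: (hle n); lra.
  apply: continuous_FTC2 => //.
  - apply: continuous_within_itv => x /andP[_ xt].
    have tx : 0 < t - x by move: (hpos n); lra.
    apply: (@continuous_comp _ _ _ (fun x => t - x) (fun y => y `^ (- g))).
      by apply: cvgB; [exact: cvg_cst|exact: cvg_id].
    exact: is_derive_continuous (is_derive1_powR (- g) tx).
  - split.
    + by move=> x; rewrite in_itv/= => /andP[_ xt]; have [] // := dF x _; move: (hpos n); lra.
    + by apply: cvg_at_right_filter; apply: is_derive_continuous (dF a at_).
    + by apply: cvg_at_left_filter; apply: is_derive_continuous (dF (t - h n) _); move: (hpos n); lra.
  - move=> x; rewrite in_itv/= => /andP[_ xt]; rewrite derive1E.
    by have [|_ ->//] := dF x _; move: (hpos n); lra.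
have Ebig : \bigcup_n E n = `[a, t[%classic.
  apply/seteqP; split=> x /=.
    by move=> [n _]; rewrite /E/= !in_itv/= => /andP[-> /=]; move: (hpos n); lra.
  rewrite in_itv/= => /andP[ax xt].
  have tx : 0 < t - x by rewrite subr_gt0.
  have := archi_boundP (divr_ge0 (ltW (_ : 0 < t - a)) (ltW tx)); rewrite subr_gt0 => /(_ at_).
  set n := Num.bound _ => hn; exists n => //; rewrite /E/= in_itv/= ax/=.
  suff : h n <= t - x by lra.
  rewrite /h ler_pdivrMr// mulrC -ler_pdivrMr//; apply: le_trans (ltW hn) _.
  by rewrite ler_nat -addn2 leq_addr.
have hcvg : F (t - h n) @[n --> \oo] --> 0.
  have hn0 : h n @[n --> \oo] --> 0.
    rewrite -(mulr0 (t - a)); apply: cvgM; first exact: cvg_cst.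
    by have := @cvg_harmonic R; rewrite -(@cvg_shiftS _ (@harmonic R)).
  have -> : (fun n => F (t - h n)) = (fun n => - (`|h n| `^ (1 - g) / (1 - g))).
    by apply/funext => n; rewrite /F opprB addrC subrK ger0_norm// ltW.
  rewrite -[X in _ --> X]oppr0; apply: cvgN.
  rewrite -[X in _ --> X](mul0r (1 - g)^-1); apply: cvgM; last exact: cvg_cst.
  have := continuous_cvg _ (@continuous_norm_powR (1 - g) h0 0) hn0.
  by rewrite normr0 powR0//; apply.
have mf A : measurable_fun A (EFin \o f) by apply/measurable_EFinP; exact: kernel_measurable.
have lim1 : (\int[lebesgue_measure]_(x in E i) (EFin \o f) x)%E @[i --> \oo] -->
    (\int[lebesgue_measure]_(x in `[a, t[) (EFin \o f) x)%E.
  rewrite -Ebig; apply: ge0_nondecreasing_set_cvg_integral => //.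
  - move=> n m nm; apply/subsetPset => x; rewrite /E/= !in_itv/= => /andP[-> /= xn].
    apply: le_trans xn _; rewrite lerD2l lerN2 ler_wpM2l//; first by rewrite subr_ge0 ltW.
    by rewrite lef_pV2 ?posrE// ler_nat.
  - by move=> n; exact: measurable_itv.
  - by move=> n; exact: mf.
  - by move=> n x _; rewrite lee_fin powR_ge0.
have lim2 : (\int[lebesgue_measure]_(x in E i) (EFin \o f) x)%E @[i --> \oo] --> (- F a)%:E.
  have -> : (fun i => \int[lebesgue_measure]_(x in E i) (EFin \o f) x)%E =
      EFin \o (fun n => F (t - h n) - F a).
    by apply/funext => n; rewrite /= Eint EFinB.
  apply: cvg_EFin; first exact: nearW.
  by rewrite -[X in _ --> X]add0r; apply: cvgB => //; exact: cvg_cst.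
have main : (\int[lebesgue_measure]_(x in `[a, t]) (f x)%:E = (- F a)%:E)%E.
  rewrite -integral_itv_bndo_bndc//; exact: (cvg_unique _ lim1 lim2).
split.
  apply/integrableP; split; first exact: mf.
  rewrite (_ : (\int[_]_(_ in _) _)%E = (- F a)%:E) ?ltry// -main.
  by apply: eq_integral => x _ /=; rewrite ger0_norm// powR_ge0.
by rewrite /Defs.Rint /Rintegral main/= /F opprK.
Qed.

End PowerFunctions.

(** * Iterated integrals of compactly supported functions *)

Section IteratedIntegral.
Variable R : realType.

(** Compactness turns the neighbourhoods of the points [(x0, y)] into one neighbourhood of [x0].
    This supplies the uniform estimates over the box and over time intervals used below. Near a
    given [y], both values are compared with the one at [(x0, y)], hence the halved [e]. *)
Lemma tube (X Y : topologicalType) (h : X * Y -> R) (K : set Y) (x0 : X) (e : R) :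
  compact K -> (forall y, K y -> {for (x0, y), continuous h}) -> 0 < e ->
  \forall x \near x0, forall y, K y -> `|h (x, y) - h (x0, y)| < e.
Proof.
move=> /compact_near_coveringP cK ch e0.
apply: (cK X (nbhs x0) (fun x y => `|h (x, y) - h (x0, y)| < e)) => y Ky.
have e20 : 0 < e / 2 by rewrite divr_gt0.
have /cvgrPdist_lt/(_ _ e20)[[U V] /= [Ux Vy] UV] := ch y Ky.
exists (V, U) => //= -[y' x'] /= [Vy' Ux'].
have h1 := UV (x', y') (conj Ux' Vy').
have h2 := UV (x0, y') (conj (nbhs_singleton Ux) Vy').
rewrite (_ : _ - _ = (h (x0, y) - h (x0, y')) - (h (x0, y) - h (x', y'))); last ring.
by rewrite (le_lt_trans (ler_normB _ _))// (splitr e) ltrD.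
Qed.

(** Stated coordinate by coordinate, so that freezing the first coordinate leaves the same condition
    on the others and inductions on the dimension go through. *)
Definition supported n (L : R) (f : 'rV[R]_n -> R) :=
  forall z : 'rV[R]_n, (exists i, L < `|z 0 i|) -> f z = 0.

Definition CK n (L : R) (f : 'rV[R]_n -> R) := continuous f /\ supported L f.

Definition box n (L : R) : set 'rV[R]_n := [set z : 'rV[R]_n | forall i, `|z 0 i| <= L].

Lemma compact_box n (L : R) : compact (@box n L).
Proof.
have -> : @box n L = [set v : 'rV[R]_n | forall i, `[(- L), L]%classic (v ord0 i)].
  by apply/seteqP; split=> v /= hv i; move: (hv i); rewrite in_itv/= ler_norml.
apply: (@rV_compact R n (fun=> `[(- L), L]%classic)) => i; exact: segment_compact.
Qed.

Lemma not_box n L (z : 'rV[R]_n) : ~ @box n L z -> exists i, L < `|z 0 i|.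
Proof. by move/existsNP => [i /negP]; rewrite -ltNge; exists i. Qed.

Lemma CK_mul n L (v f : 'rV[R]_n -> R) : continuous v -> CK L f -> CK L (fun z => v z * f z).
Proof.
move=> cv [cf sf]; split; first by move=> z; apply: continuousM; [exact: cv|exact: cf].
by move=> z /sf ->; rewrite mulr0.
Qed.

Lemma CK_add n L (f g : 'rV[R]_n -> R) : CK L f -> CK L g -> CK L (fun z => f z + g z).
Proof.
move=> [cf sf] [cg sg]; split; first by move=> z; apply: continuousD; [exact: cf|exact: cg].
by move=> z hz; rewrite sf// sg// addr0.
Qed.

Lemma CK_scale n L (c : R) (f : 'rV[R]_n -> R) : CK L f -> CK L (fun z => c * f z).
Proof. by move=> hf; apply: CK_mul hf => z; exact: cst_continuous. Qed.

Definition cons_rV m (a : R) (t : 'rV[R]_m) : 'rV[R]_m.+1 :=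
  row_mx (const_mx a : 'rV[R]_1) t.

Lemma rVintS m (f : 'rV[R]_m.+1 -> R) :
  rVint f = Rintegral (@lebesgue_measure R) setT (fun a => rVint (fun t => f (cons_rV a t))).
Proof. by []. Qed.

Lemma cons_rV0 m a (t : 'rV[R]_m) : cons_rV a t 0 0 = a.
Proof.
rewrite /cons_rV (_ : (0 : 'I_m.+1) = lshift m (0 : 'I_1)); last exact/val_inj.
by apply: etrans (@row_mxEl R 1 1 m _ _ 0 0) _; rewrite mxE.
Qed.

Lemma cons_rVS m a (t : 'rV[R]_m) (i : 'I_m) : cons_rV a t 0 (rshift 1 i) = t 0 i.
Proof. exact: (@row_mxEr R 1 1 m). Qed.

Lemma cons_rV_surj m (z : 'rV[R]_m.+1) : exists a t, z = cons_rV a t.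
Proof.
exists (z 0 0), (@rsubmx R 1 1 m z); apply: etrans (esym (@hsubmxK R 1 1 m z)) _.
rewrite /cons_rV; congr (@row_mx R 1 1 m _ _); apply/rowP => i.
by rewrite !mxE ord1; congr (z _ _); exact/val_inj.
Qed.

Lemma cons_rV_continuous m : continuous (fun p : R * 'rV[R]_m => cons_rV p.1 p.2).
Proof.
move=> p; apply/cvg_ballP => e e0.
have h1 : \forall q \near p, ball p.1 e q.1 by exact: (cvg_ball cvg_fst).
have h2 : \forall q \near p, ball p.2 e q.2 by exact: (cvg_ball cvg_snd).
near=> q; split=> // i j; rewrite !ord1 /cons_rV.
have [k ->|k ->] := @split_ordP 1 m j.
  rewrite !(@row_mxEl R 1 1 m) !mxE; suff : ball p.1 e q.1 by exact.
  by near: q.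
rewrite !(@row_mxEr R 1 1 m); suff [_] : ball p.2 e q.2 by exact.
by near: q.
Unshelve. all: by end_near. Qed.

Lemma cons_rV_continuous2 m a : continuous (fun t : 'rV[R]_m => cons_rV a t).
Proof.
move=> t; apply: (@continuous_comp _ _ _ (fun t => (a, t)) (fun p => cons_rV p.1 p.2)).
  exact: (@cvg_pair _ _ _ (nbhs t) (nbhs a) (nbhs t) _ _ _ (fun=> a) id (cvg_cst a) cvg_id).
exact: cons_rV_continuous.
Qed.

Lemma CK_slice m L (f : 'rV[R]_m.+1 -> R) a : CK L f -> CK L (fun t => f (cons_rV a t)).
Proof.
move=> [cf sf]; split.
  by move=> t; apply: continuous_comp; [exact: cons_rV_continuous2|exact: cf].
by move=> t [i hi]; apply: sf; exists (rshift 1 i); rewrite cons_rVS.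
Qed.

Lemma CK_slice0 m L (f : 'rV[R]_m.+1 -> R) a : CK L f -> L < `|a| ->
  forall t, f (cons_rV a t) = 0.
Proof. by move=> [_ sf] La t; apply: sf; exists 0; rewrite cons_rV0. Qed.

Lemma integrable_CK1 (L : R) (g : R -> R) : continuous g ->
  (forall a, L < `|a| -> g a = 0) ->
  (@lebesgue_measure R).-integrable setT (EFin \o g) /\
  Rintegral (@lebesgue_measure R) setT g = Defs.Rint (- L) L g.
Proof.
move=> cg sg.
have gE : g \_ `[(- L), L] = g.
  apply/funext => a; rewrite patchE; case: ifPn => //; rewrite notin_setE/= in_itv/=.
  by rewrite -ler_norml => /negP; rewrite -ltNge => /sg.
split; last by rewrite /Defs.Rint [RHS]Rintegral_mkcond gE.
rewrite -gE -restrict_EFin; apply/integrable_restrict => //=; rewrite setTI.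
exact/integrable_itv/continuous_subspaceT.
Qed.

Lemma Rint_bound (a b M : R) (g : R -> R) : a <= b ->
  (@lebesgue_measure R).-integrable `[a, b] (EFin \o g) ->
  (forall s, a <= s <= b -> `|g s| <= M) -> `|Defs.Rint a b g| <= M * (b - a).
Proof.
move=> ab ig hM; apply: le_trans (le_normr_Rintegral _ ig) _ => //.
apply: (@le_trans _ _ (Defs.Rint a b (fun=> M))).
  apply: le_Rintegral => //.
  - exact: (integrable_norm ig).
  - by apply: integrable_itv; exact/continuous_subspaceT/cst_continuous.
rewrite /Defs.Rint Rintegral_cst//= lebesgue_measure_itv/= lte_fin.
case: ltP => [_|ba]; first by rewrite -EFinD.
have -> : b = a by apply/eqP; rewrite eq_le ba ab.
by rewrite subrr.
Qed.

End IteratedIntegral.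

Section IteratedIntegralTheory.
Variable R : realType.
Implicit Types (L M c : R).

Definition rVint_linear_bounded n L := forall (f g : 'rV[R]_n -> R) c M, CK L f -> CK L g ->
  rVint (fun z => f z + c * g z) = rVint f + c * rVint g /\
  ((forall z, `|f z| <= M) -> `|rVint f| <= (2 * L) ^+ n * M).

Lemma rVint0 n : rVint (fun _ : 'rV[R]_n => 0) = 0.
Proof.
elim: n => [//|n IH]; rewrite rVintS.
under eq_Rintegral do rewrite IH.
by rewrite /Rintegral/= integral0.
Qed.

Lemma slice_integral_continuous m L (f : 'rV[R]_m.+1 -> R) : 0 <= L ->
  rVint_linear_bounded m L -> CK L f ->
  continuous (fun a => rVint (fun t => f (cons_rV a t))) /\
  (forall a, L < `|a| -> rVint (fun t => f (cons_rV a t)) = 0).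
Proof.
move=> L0 G Kf; split; last first.
  move=> a La; rewrite -(rVint0 m); congr (@rVint R m _).
  by apply/funext => t; exact: CK_slice0 La t.
move=> a; apply/cvgrPdist_lt => e e0.
pose V := (2 * L) ^+ m.
have V0 : 0 <= V by rewrite exprn_ge0// mulr_ge0.
(* [V + 1] and not [V], which may be 0 when [L = 0]. *)
have d0 : 0 < e / (V + 1) by rewrite divr_gt0// ltr_wpDl.
have ch : continuous (fun p : R * 'rV[R]_m => f (cons_rV p.1 p.2)).
  by move=> p; apply: continuous_comp; [exact: cons_rV_continuous|exact: Kf.1].
have := @tube R _ _ _ _ a _ (@compact_box R m L) (fun y _ => ch (a, y)) d0.
apply: filterS => b hb /=.
have [E _] := G _ _ (-1) 0 (CK_slice a Kf) (CK_slice b Kf).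
rewrite (_ : rVint _ - _ = rVint (fun t => f (cons_rV a t)) +
  (-1) * rVint (fun t => f (cons_rV b t))); last by rewrite mulN1r.
rewrite -E.
have Kd : CK L (fun t => f (cons_rV a t) + -1 * f (cons_rV b t)).
  by apply: CK_add (CK_slice a Kf) (CK_scale _ (CK_slice b Kf)).
have [_ /(_ _)/le_lt_trans->//] := G _ _ 0 (e / (V + 1)) Kd Kd.
  move=> t; have [tb|/not_box tb] := pselect (@box R m L t).
    by rewrite mulN1r distrC; exact: ltW (hb t tb).
  by rewrite Kd.2// normr0 ltW.
by rewrite -/V mulrCA gtr_pMr// ltr_pdivrMr ?mul1r ?ltrDl// ltr_wpDl.
Qed.

Lemma rVint_linear_boundedP n L : 0 <= L -> rVint_linear_bounded n L.
Proof.
move=> L0; elim: n => [|n IH] f g c M Kf Kg.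
  by split=> //= h; rewrite expr0 mul1r.
have [cf sf] := slice_integral_continuous L0 IH Kf.
have [cg sg] := slice_integral_continuous L0 IH Kg.
have [jf ef] := integrable_CK1 cf sf.
have [jg eg] := integrable_CK1 cg sg.
split.
  rewrite !rVintS -RintegralZl// -RintegralD//; last first.
    by rewrite [X in _.-integrable _ X](_ : _ = fun x => (c%:E *
      (rVint (fun t => g (cons_rV x t)))%:E)%E)//; exact: integrableZl.
  apply: eq_Rintegral => a _.
  by have [-> _] := IH _ _ c 0 (CK_slice a Kf) (CK_slice a Kg).
move=> hM; rewrite rVintS ef.
have LL : - L <= L by lra.
apply: le_trans (Rint_bound (M := (2 * L) ^+ n * M) LL _ _) _.
- exact/integrable_itv/continuous_subspaceT.
- by move=> a _; have [_ ->] := IH _ _ 0 M (CK_slice a Kf) (CK_slice a Kf).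
- by rewrite exprS opprK le_eqVlt; apply/orP; left; apply/eqP; ring.
Qed.

Section Consequences.
Variables (n : nat) (L : R).
Hypothesis L0 : 0 <= L.
Implicit Types f g : 'rV[R]_n -> R.

Lemma rVintD f g : CK L f -> CK L g -> rVint (fun z => f z + g z) = rVint f + rVint g.
Proof.
move=> Kf Kg; have [] := @rVint_linear_boundedP n L L0 _ _ 1 0 Kf Kg; rewrite mul1r => <- _.
by congr (@rVint R n _); apply/funext => z; rewrite mul1r.
Qed.

Lemma CK_zero : CK L (fun _ : 'rV[R]_n => 0).
Proof. by split=> // z; exact: cst_continuous. Qed.

Lemma rVintZ c f : CK L f -> rVint (fun z => c * f z) = c * rVint f.
Proof.
move=> Kf; have [] := @rVint_linear_boundedP n L L0 _ _ c 0 CK_zero Kf; rewrite rVint0 add0r => <- _.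
by congr (@rVint R n _); apply/funext => z; rewrite add0r.
Qed.

Lemma rVintB f g : CK L f -> CK L g -> rVint (fun z => f z - g z) = rVint f - rVint g.
Proof.
move=> Kf Kg; have [] := @rVint_linear_boundedP n L L0 _ _ (-1) 0 Kf Kg; rewrite mulN1r => <- _.
by congr (@rVint R n _); apply/funext => z; rewrite mulN1r.
Qed.

Lemma rVint_norm f M : CK L f -> (forall z, `|f z| <= M) -> `|rVint f| <= (2 * L) ^+ n * M.
Proof. by move=> Kf; have [_] := @rVint_linear_boundedP n L L0 _ _ 0 M Kf Kf. Qed.

End Consequences.

Lemma rVint_ge0 n (f : 'rV[R]_n -> R) : (forall z, 0 <= f z) -> 0 <= rVint f.
Proof.
elim: n f => [f|n IH f] f0; first exact: f0.
by rewrite rVintS; apply: Rintegral_ge0 => a _; exact: IH.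
Qed.

Lemma le_rVint n L (f g : 'rV[R]_n -> R) : 0 <= L -> CK L f -> CK L g ->
  (forall z, f z <= g z) -> rVint f <= rVint g.
Proof.
move=> L0 Kf Kg fg; rewrite -subr_ge0 -(rVintB L0)//; apply: rVint_ge0 => z.
by rewrite subr_ge0.
Qed.

Lemma Rintegral_gt0 (g : R -> R) a : continuous g -> (forall x, 0 <= g x) -> 0 < g a ->
  (@lebesgue_measure R).-integrable setT (EFin \o g) ->
  0 < Rintegral (@lebesgue_measure R) setT g.
Proof.
move=> cg g0 ga ig.
have e0 : 0 < g a / 2 by rewrite divr_gt0.
have /cvgrPdist_lt/(_ _ e0)/nbhs_ballP[d /= d0 hd] := cg a.
pose D : set R := `[a, (a + d / 2)].
have mD : measurable D by exact: measurable_itv.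
have : Rintegral (@lebesgue_measure R) setT ((fun=> g a / 2) \_ D) <=
       Rintegral (@lebesgue_measure R) setT g.
  apply: le_Rintegral => //.
  - rewrite -restrict_EFin; apply/integrable_restrict => //=; rewrite setTI.
    by apply: integrable_itv; exact/continuous_subspaceT/cst_continuous.
  - move=> x _ /=; case: ifPn => [|_]; last exact: g0.
    rewrite inE/= /D/= in_itv/= => /andP[ax xd].
    have : `|g a - g x| < g a / 2.
      by apply: hd; rewrite /ball/= ltr_norml; apply/andP; split; lra.
    by rewrite ltr_norml => /andP[_]; lra.
apply: lt_le_trans; rewrite -Rintegral_mkcond Rintegral_cst//= /D lebesgue_measure_itv/=.
rewrite lte_fin ltrDl divr_gt0//= mulr_gt0//; lra.
Qed.

Lemma rVint_gt0 n L (f : 'rV[R]_n -> R) z0 : 0 <= L -> CK L f ->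
  (forall z, 0 <= f z) -> 0 < f z0 -> 0 < rVint f.
Proof.
move=> L0; elim: n f z0 => [f z0|n IH f z0] Kf f0 fz0.
  by rewrite /= (_ : 0 = z0)//; apply/rowP => -[].
have [a [t zE]] := cons_rV_surj z0.
have [cf sf] := slice_integral_continuous L0 (@rVint_linear_boundedP n L L0) Kf.
have [jf _] := integrable_CK1 cf sf.
rewrite rVintS; apply: (@Rintegral_gt0 _ a) => //.
  by move=> x; apply: rVint_ge0.
by apply: (IH _ t (CK_slice a Kf)) => //; rewrite -zE.
Qed.

Lemma rVint_continuous n L (Phi : 'rV[R]_n -> R -> R) (t0 : R) : 0 <= L ->
  (forall t, CK L (fun z => Phi z t)) ->
  (forall e : R, 0 < e -> \forall t \near t0, forall z, `|Phi z t - Phi z t0| <= e) ->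
  {for t0, continuous (fun t => rVint (fun z => Phi z t))}.
Proof.
move=> L0 K h; apply/cvgrPdist_lt => e e0.
pose V := (2 * L) ^+ n.
have V0 : 0 <= V by rewrite exprn_ge0// mulr_ge0.
have d0 : 0 < e / (V + 1) by rewrite divr_gt0// ltr_wpDl.
have := h _ d0; apply: filterS => t ht.
rewrite -(rVintB L0)//; apply: le_lt_trans (_ : V * (e / (V + 1)) < e).
  apply: (rVint_norm L0) => [|z]; last by rewrite distrC.
  have := CK_add (K t0) (CK_scale (-1) (K t)).
  by congr (CK L _); apply/funext => z; rewrite mulN1r.
by rewrite mulrCA gtr_pMr// ltr_pdivrMr ?mul1r ?ltrDl// ltr_wpDl.
Qed.

End IteratedIntegralTheory.

(** * Test functions *)

Section Cutoff.
Variable R : realType.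

(** Increment estimates without division are what the applications provide; the Caratheodory slope
    function turns them into a derivative. *)
Lemma is_derive_littleo (f : R -> R) (x d : R) :
  (forall e : R, 0 < e -> \forall y \near x, `|f y - f x - d * (y - x)| <= e * `|y - x|) ->
  is_derive x 1 f d.
Proof.
move=> h; apply/is_derive1_caratheodory.
exists (fun z => if z == x then d else (f z - f x) / (z - x)); split.
- move=> z; case: eqVneq => [->|zx]; first by rewrite !subrr mulr0.
  by rewrite divfK// subr_eq0.
- apply/cvgrPdist_le => e e0; have := h e e0; apply: filterS => y hy /=.
  rewrite eqxx; case: eqVneq => [_|yx]; first by rewrite subrr normr0 ltW.
  have yx0 : y - x != 0 by rewrite subr_eq0.
  rewrite distrC -(ler_pM2r (_ : 0 < `|y - x|)) ?normr_gt0//.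
  by rewrite -normrM mulrBl divfK.
- by rewrite eqxx.
Qed.

Let pos (x : R) := Num.max x 0.

Lemma pos_ge0 x : 0 <= pos x. Proof. by rewrite le_max lexx orbT. Qed.

Lemma mul_pos x : x * pos x = pos x ^+ 2.
Proof. by rewrite expr2 /pos; case: (leP x 0) => // _; rewrite !mulr0. Qed.

(** Whatever the signs of [x] and [y], the remainder is at most [(y - x) ^+ 2] in absolute value, so
    the corner at 0 needs no separate limit. *)
Lemma is_derive_pos2 (x : R) : is_derive x 1 (fun y => pos y ^+ 2) (2 * pos x).
Proof.
apply: is_derive_littleo => e e0.
near=> y; have ye : `|y - x| <= e.
  by near: y; have /cvgrPdist_le/(_ e e0) := (@cvg_id _ (nbhs x)); apply: filterS => y; rewrite distrC.
apply: (@le_trans _ _ (`|y - x| * `|y - x|)); last by rewrite ler_wpM2r.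
rewrite -normrM -expr2 ger0_norm ?sqr_ge0// ler_norml /pos.
have s1 := sqr_ge0 (y - x); have s2 := sqr_ge0 x; have s3 := sqr_ge0 y.
case: (leP x 0) => x0; case: (leP y 0) => y0.
- by apply/andP; split; nra.
- by have := mulr_le0_ge0 x0 (ltW y0); move=> h; apply/andP; split; nra.
- by have := mulr_ge0_le0 (ltW x0) y0; move=> h; apply/andP; split; nra.
- by apply/andP; split; nra.
Unshelve. all: by end_near. Qed.

Lemma is_derive_pos3 (x : R) : is_derive x 1 (fun y => pos y ^+ 3) (3 * pos x ^+ 2).
Proof.
have -> : (fun y => pos y ^+ 3) = (fun y => y * pos y ^+ 2).
  apply/funext => y; rewrite (_ : y * pos y ^+ 2 = y * pos y * pos y); last by rewrite -mulrA.
  by rewrite mul_pos -exprSr.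
apply: is_derive_eq (is_derive_mul (is_derive_var x) (is_derive_pos2 x)) _.
by rewrite mul1r (mulrCA x) mul_pos; ring.
Qed.

Variable L : R.

(** [m] is the order of differentiation of [(L^2 - s^2)_+^3]. The cube is the smallest integer power
    with a continuous second derivative. The value 0 from order 3 on is a filler, not a
    derivative. *)
Definition bump (m : nat) (s : R) : R :=
  let r := pos (L ^+ 2 - s ^+ 2) in
  match m with
  | 0 => r ^+ 3
  | 1 => - 6 * s * r ^+ 2
  | 2 => - 6 * r ^+ 2 + 24 * s ^+ 2 * r
  | _ => 0
  end.

Lemma is_derive_bump m (s : R) : (m <= 1)%N -> is_derive s 1 (bump m) (bump m.+1 s).
Proof.
have hs : is_derive s 1 (fun s => L ^+ 2 + - s ^+ 2) (- (2 * s)).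
  apply: is_derive_eq (is_derive_add (is_derive_const s _)
    (is_derive_opp (is_derive_pow 2 (is_derive_var s)))) _.
  by rewrite /= expr1 mulr1 add0r.
case: m => [|[|//]] _.
  have := @is_derive_chain R (fun y => pos y ^+ 3) (fun s => L ^+ 2 + - s ^+ 2) s _ _
    (is_derive_pos3 _) hs.
  by move/is_derive_eq; apply; rewrite /bump; ring.
have h2 := @is_derive_chain R (fun y => pos y ^+ 2) (fun s => L ^+ 2 + - s ^+ 2) s _ _
  (is_derive_pos2 _) hs.
have := is_derive_mul (is_derive_scale (- 6) (is_derive_var s)) h2.
by move/is_derive_eq; apply; rewrite /bump; ring.
Qed.

Lemma bump_continuous m : continuous (bump m).
Proof.
have cr : continuous (fun s : R => pos (L ^+ 2 - s ^+ 2)).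
  move=> s; apply: (@continuous_comp _ _ _ (fun s : R => L ^+ 2 - s ^+ 2)).
    by apply: continuousB; [exact: cst_continuous|exact: exprn_continuous].
  exact: continuous_max0.
have crn j : continuous (fun s : R => pos (L ^+ 2 - s ^+ 2) ^+ j).
  move=> s; apply: (@continuous_comp _ _ _ (fun s : R => pos (L ^+ 2 - s ^+ 2)) (fun x : R => x ^+ j)).
    exact: cr.
  exact: exprn_continuous.
have cl (c : R) j : continuous (fun s : R => c * s ^+ j).
  move=> s; exact: (cvgM (cvg_cst c) (@exprn_continuous R j s)).
case: m => [|[|[|m]]] s; last exact: cst_continuous.
- exact: crn.
- exact: (cvgM (cl (- 6) 1%N s) (crn 2 s)).
- apply: (@cvgD _ R^o _ (nbhs s) _ (fun t : R => - 6 * pos (L ^+ 2 - t ^+ 2) ^+ 2)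
    (fun t : R => 24 * t ^+ 2 * pos (L ^+ 2 - t ^+ 2))).
    exact: (cvgM (cvg_cst (- 6 : R)) (crn 2%N s)).
  exact: (cvgM (cl 24 2%N s) (cr s)).
Qed.

Lemma bump_supp m s : 0 <= L -> L < `|s| -> bump m s = 0.
Proof.
move=> L0 Ls; have r0 : pos (L ^+ 2 - s ^+ 2) = 0.
  by rewrite /pos max_r// subr_le0 -[leRHS]real_normK ?num_real// ler_pXn2r ?nnegrE// ltW.
by case: m => [|[|[|m]]]; rewrite /bump/= ?r0 ?expr0n/= ?mulr0 ?addr0.
Qed.

Lemma bump_ge0 s : 0 <= bump 0 s.
Proof. by rewrite exprn_ge0// pos_ge0. Qed.

Lemma bump_gt0 s : `|s| < L -> 0 < bump 0 s.
Proof.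
move=> sL; rewrite exprn_gt0// /pos lt_max subr_gt0 -[ltLHS]real_normK ?num_real//.
by rewrite ltr_pXn2r ?nnegrE ?sL// (le_trans _ (ltW sL)).
Qed.

(* With [r = L^2 - s^2 > 0] the difference is [r (24 L^2 - 30 r + 10 r^2)], whose second factor has
   negative discriminant. *)
Lemma bump2_ge s : 1 <= L -> - 10 * bump 0 s <= bump 2 s.
Proof.
move=> L1; rewrite /bump/= /pos; case: (leP (L ^+ 2 - s ^+ 2) 0) => [_|r0]; first by rewrite !expr0n/= !mulr0 addr0.
set r := _ - _ in r0 *; have -> : s ^+ 2 = L ^+ 2 - r by rewrite /r; ring.
have L2 : 1 <= L ^+ 2 by rewrite exprn_ege1.
rewrite -subr_ge0.
rewrite (_ : _ - _ = r * (24 * L ^+ 2 - 30 * r + 10 * r ^+ 2)); last ring.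
rewrite mulr_ge0//; first exact: ltW.
have := sqr_ge0 (r - 3 / 2); lra.
Qed.

End Cutoff.

Section ProductBump.
Variables (R : realType) (n : nat) (L : R).
Hypothesis L1 : 1 <= L.
Let L0 : 0 <= L. Proof. exact: le_trans ler01 L1. Qed.

(** [o] is a multi-index of derivative orders. A partial derivative merely raises one entry through
    [incr], so all derivatives up to order two stay in one family whose continuity and support are
    proved once. *)
Definition prod_bump (o : 'I_n -> nat) (z : 'rV[R]_n) : R := \prod_i bump L (o i) (z 0 i).

Lemma prod_bump_continuous o : continuous (prod_bump o).
Proof.
move=> z; apply: (@cvg_big _ _ _ _ _ _ _ (nbhs z)) => [|i _]; first exact: mul_continuous.
apply: (@continuous_comp _ _ _ (fun w : 'rV[R]_n => w 0 i)); first exact: coord_continuous.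
exact: bump_continuous.
Qed.

Lemma CK_prod_bump o : CK L (prod_bump o).
Proof.
split; first exact: prod_bump_continuous.
by move=> z [i hi]; rewrite /prod_bump (bigD1 i)//= bump_supp// mul0r.
Qed.

Definition incr (i : 'I_n) (o : 'I_n -> nat) (j : 'I_n) : nat := ((j == i) + o j)%N.

(** A directional derivative sees only the line through [z], and on it a product of one-variable
    functions is a constant times its [i]-th factor. *)
Lemma is_derive_slot (f : 'rV[R]_n -> R) (z : 'rV[R]_n) (i : 'I_n) (K : R) (c : R -> R) (dc : R) :
  (forall h, f (h *: delta_mx 0 i + z) = K * c (h + z 0 i)) ->
  is_derive (z 0 i) 1 c dc -> is_derive z (delta_mx 0 i) f (K * dc).
Proof.
move=> hf [dcd dcE].
have hz : f z = K * c (z 0 i) by have := hf 0; rewrite scale0r !add0r.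
have : (fun h => h^-1 *: ((f \o shift z) (h *: delta_mx 0 i) - f z)) @ 0^' --> K * dc.
  have -> : (fun h => h^-1 *: ((f \o shift z) (h *: delta_mx 0 i) - f z)) =
      (fun h => K * (h^-1 *: ((c \o shift (z 0 i)) (h *: 1) - c (z 0 i)))).
    apply/funext => h /=; rewrite hf hz -mulrBr [h *: 1]mulr1.
    by rewrite /GRing.scale/= mulrCA.
  by apply: cvgM; [exact: cvg_cst|rewrite -dcE; exact: dcd].
move=> hc; split; first exact: cvgP hc.
exact: cvg_lim hc.
Qed.

Lemma is_derive_prod_bump o i z (c : R) : (o i <= 1)%N ->
  is_derive z (delta_mx 0 i) (fun w => prod_bump o w * c) (prod_bump (incr i o) z * c).
Proof.
move=> oi; pose K := c * \prod_(j | j != i) bump L (o j) (z 0 j).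
have -> : prod_bump (incr i o) z * c = K * bump L (o i).+1 (z 0 i).
  rewrite /prod_bump (bigD1 i)//= /incr eqxx add1n /K mulrC -mulrA [X in c * X]mulrC.
  congr (_ * (_ * _)); apply: eq_bigr => j /negbTE ->; by [].
apply: (is_derive_slot (c := bump L (o i))); last exact: is_derive_bump.
move=> h; rewrite /prod_bump (bigD1 i)//= !mxE !eqxx mulr1 /K mulrC -mulrA [X in c * X]mulrC.
congr (_ * (_ * _)); apply: eq_bigr => j /negbTE ji.
by rewrite !mxE ji andbF mulr0 add0r.
Qed.

Lemma pd_prod_bump o i (c : R) : (o i <= 1)%N ->
  pd i (fun w => prod_bump o w * c) = (fun w => prod_bump (incr i o) w * c).
Proof. by move=> oi; apply/funext => z; have [_] := is_derive_prod_bump z c oi. Qed.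

Definition cutoff := prod_bump (fun=> 0%N).

Lemma cutoff_ge0 z : 0 <= cutoff z.
Proof. by apply: prodr_ge0 => i _; exact: bump_ge0. Qed.

Lemma cutoff_gt0 (z : 'rV[R]_n) : (forall i, `|z 0 i| < L) -> 0 < cutoff z.
Proof. by move=> hz; apply: prodr_gt0 => i _; exact: bump_gt0. Qed.

Lemma norm_gt_coord (z : 'rV[R]_n) : L < `|z| -> exists i, L < `|z 0 i|.
Proof.
move=> Lz; apply: contrapT => h; move: Lz; rewrite ltNge => /negP; apply.
rewrite {1}/Num.norm/= mx_normrE; apply/bigmax_leP; split=> // -[a b] _ /=.
by rewrite ord1 leNgt; apply/negP => hb; apply: h; exists b.
Qed.

Lemma incr1 i j : (incr i (fun=> 0%N) j <= 1)%N.
Proof. by rewrite /incr addn0 leq_b1. Qed.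

Lemma test_fun_cutoff (T : R) (eta deta : R -> R) :
  (forall t : R, is_derive t 1 eta (deta t)) -> continuous deta -> eta T = 0 ->
  test_fun T (fun z t => cutoff z * eta t).
Proof.
move=> he cd eT.
have ce : continuous eta by move=> t; exact: is_derive_continuous (he t).
have cc o (g : R -> R) : continuous g ->
    continuous (fun p : 'rV[R]_n * R => prod_bump o p.1 * g p.2).
  move=> cg p.
  have h1 : {for p, continuous (fun p : 'rV[R]_n * R => prod_bump o p.1)}.
    by apply: continuous_comp; [exact: cvg_fst|exact: prod_bump_continuous].
  have h2 : {for p, continuous (fun p : 'rV[R]_n * R => g p.2)}.
    by apply: continuous_comp; [exact: cvg_snd|exact: cg].
  exact: (cvgM h1 h2).
have dE (z : 'rV[R]_n) (t : R) : is_derive t 1 (fun s => cutoff z * eta s) (cutoff z * deta t).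
  exact: is_derive_scale.
split; last by move=> z; rewrite eT mulr0.
  split; first by move=> z t; have [] := dE z t.
  split; first by move=> i z t; have [] := @is_derive_prod_bump (fun=> 0%N) i z (eta t).
  split.
    move=> i j z t; rewrite /cutoff pd_prod_bump//.
    by have [] := is_derive_prod_bump z (eta t) (incr1 i j).
  split; first exact: cc.
  split.
    have -> : (fun p : 'rV[R]_n * R => dt (fun z t => cutoff z * eta t) p.1 p.2) =
        (fun p => cutoff p.1 * deta p.2).
      by apply/funext => p; rewrite /dt derive1E; have [_] := dE p.1 p.2.
    exact: cc.
  split=> [i|i j].
    have -> : (fun p : 'rV[R]_n * R => pd i (fun w => cutoff w * eta p.2) p.1) =
        (fun p => prod_bump (incr i (fun=> 0%N)) p.1 * eta p.2).
      by apply/funext => p; rewrite /cutoff pd_prod_bump.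
    exact: cc.
  have -> : (fun p : 'rV[R]_n * R => pd j (pd i (fun w => cutoff w * eta p.2)) p.1) =
      (fun p => prod_bump (incr j (incr i (fun=> 0%N))) p.1 * eta p.2).
    by apply/funext => p; rewrite /cutoff pd_prod_bump// pd_prod_bump// incr1.
  exact: cc.
exists L => z t _ /norm_gt_coord hz.
by rewrite /cutoff (CK_prod_bump (fun=> 0%N)).2// mul0r.
Qed.

(** Both sides share the nonnegative factors of the coordinates other than [i], which reduces the
    claim to [bump2_ge]. *)
Lemma prod_bump2_ge i z : - 10 * cutoff z <= prod_bump (incr i (incr i (fun=> 0%N))) z.
Proof.
rewrite /cutoff /prod_bump (bigD1 i)//= [leRHS](bigD1 i)//= mulrA.
rewrite [X in _ <= _ * X](eq_bigr (fun j => bump L 0 (z 0 j))); last first.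
  by move=> j /negbTE ji; rewrite /incr ji.
apply: ler_wpM2r; first by apply: prodr_ge0 => j _; exact: bump_ge0.
by rewrite /incr eqxx; exact: bump2_ge.
Qed.

End ProductBump.

Section GrushinCutoff.
Variables (R : realType) (N k : nat) (L : R).
Hypothesis L1 : 1 <= L.
Implicit Types z : 'rV[R]_(N + k).

Let d2 i : 'rV[R]_(N + k) -> R := prod_bump L (incr i (incr i (fun=> 0%N))).

Definition grushin_cutoff z : R :=
  \sum_(i < N) d2 (lshift k i) z +
  (\sum_(i < N) (z 0 (lshift k i)) ^+ 2) * \sum_(j < k) d2 (rshift N j) z.

Lemma grushin_cutoffE z (c : R) :
  grushin (fun w => cutoff L w * c) z = grushin_cutoff z * c.
Proof.
rewrite /grushin /grushin_cutoff mulrDl -mulrA.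
by congr (_ + _ * _); rewrite mulr_suml; apply: eq_bigr => i _; rewrite /cutoff !pd_prod_bump// incr1.
Qed.

(** Each second derivative costs [10 * cutoff]. The unbounded coefficient [|x|^2] is at most [N L^2]
    on the box, and outside it the cutoff vanishes. *)
Lemma grushin_cutoff_ge z :
  - (10 * N%:R + 10 * k%:R * (N%:R * L ^+ 2)) * cutoff L z <= grushin_cutoff z.
Proof.
have c0 := cutoff_ge0 L z.
have h1 m (h : 'I_m -> 'I_(N + k)) : - 10 * m%:R * cutoff L z <= \sum_i d2 (h i) z.
  apply: (@le_trans _ _ (\sum_(i < m) - 10 * cutoff L z)).
    by rewrite sumr_const card_ord -[leRHS]mulr_natl mulrA (mulrC m%:R).
  by apply: ler_sum => i _; exact: prod_bump2_ge.
have S0 : 0 <= \sum_(i < N) z 0 (lshift k i) ^+ 2 by apply: sumr_ge0 => i _; exact: sqr_ge0.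
have hS : (\sum_(i < N) z 0 (lshift k i) ^+ 2) * cutoff L z <= N%:R * L ^+ 2 * cutoff L z.
  have [zb|/not_box zb] := pselect (@box R (N + k) L z); last first.
    by rewrite /cutoff (CK_prod_bump L1 (fun=> 0%N)).2// !mulr0.
  apply: ler_wpM2r => //; apply: (@le_trans _ _ (\sum_(i < N) L ^+ 2)).
    apply: ler_sum => i _; rewrite -real_normK ?num_real//.
    by apply: lerXn2r; rewrite ?nnegrE ?normr_ge0 ?(le_trans ler01 L1)//; exact: zb.
  by rewrite sumr_const card_ord mulr_natl.
have hA := h1 N (lshift k); have hB := ler_wpM2l S0 (h1 k (@rshift N k)).
rewrite /grushin_cutoff; move: hA hB hS.
have := ler0n R k; move: (\sum_(i < N) _) (\sum_(i < N) _) (\sum_(i < k) _) => a s b k0 h2 h3 h4.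
have := ler_wpM2l k0 h4; lra.
Qed.

Lemma CK_grushin_cutoff : CK L grushin_cutoff.
Proof.
have K i : CK L (d2 i) by exact: CK_prod_bump.
have KS m (h : 'I_m -> 'I_(N + k)) : CK L (fun z => \sum_i d2 (h i) z).
  split; last by move=> z hz; apply: big1 => i _; exact: (K (h i)).2 z hz.
  by move=> z; apply: (@cvg_big _ _ _ _ _ _ _ (nbhs z)) => [|i _]; [exact: add_continuous|exact: (K (h i)).1 z].
apply: CK_add; first exact: KS.
apply: CK_mul (KS _ _) => z; apply: (@cvg_big _ _ _ _ _ _ _ (nbhs z)) => [|i _]; first exact: add_continuous.
apply: (@continuous_comp _ _ _ (fun w : 'rV[R]_(N + k) => w 0 (lshift k i)) (fun x : R => x ^+ 2)).
  exact: coord_continuous.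
exact: exprn_continuous.
Qed.

End GrushinCutoff.

(** * The memory term *)

Section WeightedIntegrals.
Variable R : realType.
Implicit Types (a b c : R) (f g k : R -> R).
Local Notation mu := (@lebesgue_measure R).

Lemma compact_bound (X : topologicalType) (K : set X) (f : X -> R) :
  compact K -> continuous f -> exists2 W : R, 0 <= W & forall x, K x -> `|f x| <= W.
Proof.
move=> cK cf.
have cfK : compact (f @` K) by apply: continuous_compact => //; exact: continuous_subspaceT.
have [M [_ hM]] := @compact_bounded _ R^o _ cfK.
exists (`|M| + 1); first by rewrite addr_ge0.
move=> x Kx; apply: (hM (`|M| + 1)); last by exists x.
by rewrite (le_lt_trans (ler_norm M))// ltrDl.
Qed.

Lemma integrable_sub a b c d f : a <= c -> d <= b ->
  mu.-integrable `[a, b] (EFin \o f) -> mu.-integrable `[c, d] (EFin \o f).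
Proof.
move=> ac db; apply: integrableS => //.
by move=> x /=; rewrite !in_itv/= => /andP[cx xd]; rewrite (le_trans ac cx) (le_trans xd db).
Qed.

Lemma Rint_chasles a b c f : a <= b -> b <= c -> mu.-integrable `[a, c] (EFin \o f) ->
  Defs.Rint a c f - Defs.Rint a b f = Defs.Rint b c f.
Proof.
move=> ab bc fi; rewrite /Defs.Rint Rintegral_itvB ?bnd_simp//.
rewrite Rintegral_itv_obnd_cbnd//; apply: integrableS fi => //.
by move=> x /=; rewrite !in_itv/= => /andP[bx ->]; rewrite (le_trans ab (ltW bx)).
Qed.

(* The comparison excludes [s = b] because the memory kernel [(b - s) `^ (- gamma)] takes the junk
   value [0 `^ (- gamma) = 0] there. *)
Lemma le_Rint_co a b f g : mu.-integrable `[a, b] (EFin \o f) ->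
  mu.-integrable `[a, b] (EFin \o g) -> (forall s, a <= s < b -> f s <= g s) ->
  Defs.Rint a b f <= Defs.Rint a b g.
Proof.
move=> fi gi fg.
have sub : `[a, b[ `<=` `[a, b] by move=> x /=; rewrite !in_itv/= => /andP[-> /ltW ->].
have fi' : mu.-integrable `[a, b[ (EFin \o f) by exact: integrableS fi.
have gi' : mu.-integrable `[a, b[ (EFin \o g) by exact: integrableS gi.
rewrite /Defs.Rint -(Rintegral_itv_bndo_bndc fi') -(Rintegral_itv_bndo_bndc gi').
by apply: le_Rintegral => // x /=; rewrite in_itv; exact: fg.
Qed.

Lemma integrable_scale a b c f : mu.-integrable `[a, b] (EFin \o f) ->
  mu.-integrable `[a, b] (EFin \o (fun s => c * f s)).
Proof. by move=> fi; apply: (integrableZl _ c fi). Qed.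

Lemma integrable_diff a b f g : mu.-integrable `[a, b] (EFin \o f) ->
  mu.-integrable `[a, b] (EFin \o g) -> mu.-integrable `[a, b] (EFin \o (fun s => f s - g s)).
Proof.
have mI : measurable (`[a, b]%classic : set (measurableTypeR R)) by exact: measurable_itv.
by move=> fi gi; have := integrableB mI fi gi; exact.
Qed.

Lemma integrable_weight a b k g : mu.-integrable `[a, b] (EFin \o k) -> continuous g ->
  mu.-integrable `[a, b] (EFin \o (fun s => k s * g s)).
Proof.
move=> ki cg; apply: (integrableMl _ ki) => //.
  by apply: measurable_funTS; exact: continuous_measurable_fun.
have [W W0 hW] := compact_bound (@segment_compact R a b) cg.
exists W; split; first exact: num_real.
by move=> M WM x xab; apply: le_trans (hW x xab) (ltW WM).
Qed.

(** The weight is assumed nonnegative only before [b]: the difference of two kernels in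
    [mem_int_holder_le] can be negative at the endpoint, where the first one takes its default
    value. *)
Lemma Rint_weight a b k g W : mu.-integrable `[a, b] (EFin \o k) -> continuous g ->
  (forall s, a <= s < b -> 0 <= k s) -> (forall s, a <= s <= b -> `|g s| <= W) ->
  `|Defs.Rint a b (fun s => k s * g s)| <= W * Defs.Rint a b k.
Proof.
move=> ki cg k0 gW; have kgi := integrable_weight ki cg.
have h (c : R) : Defs.Rint a b (fun s => c * k s) = c * Defs.Rint a b k.
  by rewrite /Defs.Rint RintegralZl.
have gs s : a <= s < b -> - W <= g s <= W.
  by move=> /andP[as_ sb]; rewrite -ler_norml; apply: gW; rewrite as_ ltW.
rewrite ler_norml -mulNr -!h; apply/andP; split; apply: le_Rint_co => //.
- exact: integrable_scale.
- by move=> s hs; rewrite mulrC ler_wpM2l ?k0//; have /andP[] := gs s hs.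
- exact: integrable_scale.
- by move=> s hs; rewrite [leRHS]mulrC ler_wpM2l ?k0//; have /andP[] := gs s hs.
Qed.

Lemma Rint_neg a b f : b <= a -> Defs.Rint a b f = 0.
Proof.
rewrite le_eqVlt => /predU1P[->|ba]; first by rewrite /Defs.Rint set_itv1 Rintegral_set1.
by rewrite /Defs.Rint set_itv_ge ?Rintegral_set0// bnd_simp -ltNge.
Qed.

End WeightedIntegrals.

Section Memory.
Variables (R : realType) (gam : R).
Hypotheses (gam0 : 0 <= gam) (gam1 : gam < 1).
Implicit Types (t s : R).
Local Notation mu := (@lebesgue_measure R).

Let ker t s := (t - s) `^ (- gam).
Let kap (x : R) := x `^ (1 - gam) / (1 - gam).

Let ker_int a t : a <= t -> mu.-integrable `[a, t] (EFin \o ker t).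
Proof. by move=> at_; have [] := kernel_integral gam0 gam1 at_. Qed.

Let kapE a t : a <= t -> Defs.Rint a t (ker t) = kap (t - a).
Proof. by move=> at_; have [] := kernel_integral gam0 gam1 at_. Qed.

Let ker_ge0 t s : 0 <= ker t s. Proof. exact: powR_ge0. Qed.

Lemma kap_le x y : 0 <= x -> x <= y -> kap x <= kap y.
Proof.
move=> x0 xy; rewrite ler_pM2r ?invr_gt0 ?subr_gt0// ge0_ler_powR ?nnegrE ?subr_ge0 ?(ltW gam1)//.
exact: le_trans xy.
Qed.

Definition mem_int (v : R -> R) t := Defs.Rint 0 t (fun s => ker t s * v s).

Lemma mem_int_norm v t W : continuous v -> 0 <= t ->
  (forall s, 0 <= s <= t -> `|v s| <= W) -> `|mem_int v t| <= W * kap t.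
Proof.
move=> cv t0 hW; rewrite -[in kap _](subr0 t) -kapE//.
by apply: Rint_weight => //; exact: ker_int.
Qed.

Lemma mem_intB v v' t : continuous v -> continuous v' -> 0 <= t ->
  mem_int v t - mem_int v' t = mem_int (fun s => v s - v' s) t.
Proof.
move=> cv cv' t0; rewrite /mem_int /Defs.Rint -RintegralB//; last 2 first.
- by apply: integrable_weight cv; exact: ker_int.
- by apply: integrable_weight cv'; exact: ker_int.
by apply: eq_Rintegral => s _; rewrite mulrBr.
Qed.

(* The kernel decreases in time, so that both the new contribution on [[t, t']] and the loss on
   [[0, t]] are controlled by [kap (t' - t)]. *)
Lemma mem_int_holder_le v t t' W : continuous v -> 0 <= t -> t <= t' -> 0 <= W ->
  (forall s, 0 <= s <= t' -> `|v s| <= W) ->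
  `|mem_int v t' - mem_int v t| <= 2 * W * kap (t' - t).
Proof.
move=> cv t0 tt' W0 hW; have t'0 := le_trans t0 tt'.
have k'i : mu.-integrable `[0, t'] (EFin \o ker t') by exact: ker_int.
have k'i0 : mu.-integrable `[0, t] (EFin \o ker t') by exact: integrable_sub k'i.
have k'i1 : mu.-integrable `[t, t'] (EFin \o ker t') by exact: integrable_sub k'i.
have ki : mu.-integrable `[0, t] (EFin \o ker t) by exact: ker_int.
have i1 := integrable_weight k'i cv.
have E : mem_int v t' - mem_int v t = Defs.Rint t t' (fun s => ker t' s * v s) -
    Defs.Rint 0 t (fun s => (ker t s - ker t' s) * v s).
  rewrite -(Rint_chasles t0 tt' i1) /mem_int.
  have -> : Defs.Rint 0 t (fun s => (ker t s - ker t' s) * v s) =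
      Defs.Rint 0 t (fun s => ker t s * v s) - Defs.Rint 0 t (fun s => ker t' s * v s).
    rewrite /Defs.Rint -RintegralB//; [|exact: integrable_weight|exact: integrable_weight].
    by apply: eq_Rintegral => s _; rewrite mulrBl.
  ring.
have b1 : `|Defs.Rint t t' (fun s => ker t' s * v s)| <= W * kap (t' - t).
  rewrite -kapE//; apply: Rint_weight => // s /andP[ts st']; apply: hW.
  by rewrite st' (le_trans t0).
have b2 : `|Defs.Rint 0 t (fun s => (ker t s - ker t' s) * v s)| <=
    W * Defs.Rint 0 t (fun s => ker t s - ker t' s).
  apply: Rint_weight => //; first exact: integrable_diff.
  - move=> s /andP[s0 st]; rewrite subr_ge0 /ker; apply: powRN_le => //; lra.
  - by move=> s /andP[s0 st]; apply: hW; rewrite s0 (le_trans st).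
have b3 : Defs.Rint 0 t (fun s => ker t s - ker t' s) <= kap (t' - t).
  have -> : Defs.Rint 0 t (fun s => ker t s - ker t' s) =
      Defs.Rint 0 t (ker t) - Defs.Rint 0 t (ker t') by rewrite /Defs.Rint RintegralB.
  have := Rint_chasles t0 tt' k'i; rewrite !kapE// !subr0.
  have := kap_le t0 tt'; lra.
have b4 := ler_wpM2l W0 b3.
rewrite E (le_trans (ler_normB _ _))//; lra.
Qed.

(** For negative [t] the interval of integration is empty, so the memory integral is already
    constant in negative time and its estimates reduce to nonnegative times. *)
Lemma mem_int_max0 v t : mem_int v (Num.max t 0) = mem_int v t.
Proof. by rewrite /mem_int; case: (leP t 0) => // t0; rewrite !Rint_neg. Qed.

Lemma mem_int_holder v t t' T W : continuous v -> t <= T -> t' <= T -> 0 <= T -> 0 <= W ->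
  (forall s, 0 <= s <= T -> `|v s| <= W) ->
  `|mem_int v t' - mem_int v t| <= 2 * W * kap `|t' - t|.
Proof.
move=> cv + + T0 W0 hW.
have main a b : a <= b -> b <= T -> `|mem_int v b - mem_int v a| <= 2 * W * kap `|b - a|.
  move=> ab bT; rewrite -(mem_int_max0 v a) -(mem_int_max0 v b).
  have m0 : 0 <= Num.max a 0 by rewrite le_max lexx orbT.
  have mab : Num.max a 0 <= Num.max b 0 by rewrite ge_max !le_max ab lexx orbT.
  apply: le_trans (mem_int_holder_le cv m0 mab W0 _) _.
    move=> s /andP[s0 sb]; apply: hW; rewrite s0 (le_trans sb)// ge_max bT.
    exact: T0.
  apply: ler_wpM2l; first by rewrite mulr_ge0.
  rewrite ger0_norm ?subr_ge0//; apply: kap_le; rewrite ?subr_ge0//.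
  by case: (leP a 0) => a0; case: (leP b 0) => b0; lra.
move=> tT t'T; case: (leP t t') => tt'; first exact: main.
by rewrite distrC (distrC t'); apply: main => //; exact: ltW.
Qed.

Lemma kap_small W e t0 : 0 <= W -> 0 < e -> \forall t \near t0, 2 * W * kap `|t - t0| <= e.
Proof.
move=> W0 e0; have h0 : 0 < 1 - gam by rewrite subr_gt0.
have c1 : {for t0, continuous (fun t => 2 * W * kap `|t - t0|)}.
  apply: cvgM; first exact: cvg_cst.
  apply: cvgM; last exact: cvg_cst.
  apply: (@continuous_comp _ _ _ (fun t => t - t0) (fun x => `|x| `^ (1 - gam))).
    by apply: cvgB; [exact: cvg_id|exact: cvg_cst].
  exact: continuous_norm_powR.
have /cvgrPdist_le/(_ e e0) := c1; apply: filterS => t.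
rewrite subrr normr0 /kap powR0 ?gt_eqF// mul0r mulr0 sub0r normrN.
exact: le_trans (ler_norm _).
Qed.

Lemma mem_int_ge (v : R -> R) t : continuous v -> (forall s, 0 <= v s) -> 0 < t ->
  t `^ (- gam) * Defs.Rint 0 t v <= mem_int v t.
Proof.
move=> cv v0 t0.
have vi : mu.-integrable `[0, t] (EFin \o v) by apply: integrable_itv; exact: continuous_subspaceT.
have -> : t `^ (- gam) * Defs.Rint 0 t v = Defs.Rint 0 t (fun s => t `^ (- gam) * v s).
  by rewrite /Defs.Rint RintegralZl.
apply: le_Rint_co.
- exact: integrable_scale.
- by apply: integrable_weight cv; apply: ker_int; exact: ltW.
- move=> s /andP[s0 st]; apply: ler_wpM2r => //; apply: powRN_le => //; lra.
Qed.

End Memory.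

(** * Continuity in space and time, and differentiation under the integral *)

Section SpaceTime.
Variables (R : realType) (n : nat).
Local Notation mu := (@lebesgue_measure R).

Lemma joint_continuous (u : 'rV[R]_n -> R -> R) :
  (forall t, continuous (fun z => u z t)) ->
  (forall (t0 e : R), 0 < e -> \forall t \near t0, forall z, `|u z t - u z t0| < e) ->
  continuous (fun p : 'rV[R]_n * R => u p.1 p.2).
Proof.
move=> cz ct [z0 t0]; apply/cvgrPdist_lt => e e0.
have e20 : 0 < e / 2 by rewrite divr_gt0.
have h1 : \forall p \near (z0, t0), `|u z0 t0 - u p.1 t0| < e / 2.
  have /cvgrPdist_lt/(_ _ e20) := cz t0 z0.
  by move=> h; near=> p; near: p; exact: (cvg_fst h).
have h2 : \forall p \near (z0, t0), forall z, `|u z p.2 - u z t0| < e / 2.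
  have h := ct t0 _ e20.
  by near=> p; near: p; exact: (cvg_snd h).
near=> p => /=.
have a1 : `|u z0 t0 - u p.1 t0| < e / 2 by near: p.
have a2 : `|u p.1 p.2 - u p.1 t0| < e / 2 by have := (near h2 p); apply.
rewrite (_ : _ - _ = (u z0 t0 - u p.1 t0) - (u p.1 p.2 - u p.1 t0)); last ring.
by rewrite (le_lt_trans (ler_normB _ _))// (splitr e) ltrD.
Unshelve. all: by end_near. Qed.

Variables (g : 'rV[R]_n -> R -> R).
Hypothesis cg : continuous (fun p : 'rV[R]_n * R => g p.1 p.2).

Lemma joint_continuous_space t : continuous (fun z => g z t).
Proof.
move=> z; apply: (@continuous_comp _ _ _ (fun z => (z, t)) (fun p => g p.1 p.2)).
  exact: (@cvg_pair _ _ _ (nbhs z) (nbhs z) (nbhs t) _ _ _ id (fun=> t) cvg_id (cvg_cst t)).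
exact: cg.
Qed.

Lemma joint_continuous_time z : continuous (g z).
Proof.
move=> t; apply: (@continuous_comp _ _ _ (fun t => (z, t)) (fun p => g p.1 p.2)).
  exact: (@cvg_pair _ _ _ (nbhs t) (nbhs z) (nbhs t) _ _ _ (fun=> z) id (cvg_cst z) cvg_id).
exact: cg.
Qed.

Lemma near_time_box (L t0 e : R) : 0 < e ->
  \forall t \near t0, forall z, @box R n L z -> `|g z t - g z t0| < e.
Proof.
move=> e0; pose h (p : R * 'rV[R]_n) := g p.2 p.1.
have ch : continuous h.
  move=> p; apply: (@continuous_comp _ _ _ (fun p : R * 'rV[R]_n => (p.2, p.1))
    (fun p => g p.1 p.2)); last exact: cg.
  exact: (@cvg_pair _ _ _ (nbhs p) (nbhs p.2) (nbhs p.1) _ _ _ snd fst cvg_snd cvg_fst).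
exact: (@tube R _ _ h _ t0 e (@compact_box R n L) (fun y _ => ch (t0, y)) e0).
Qed.

Lemma mem_int_continuous_space (gam t : R) : 0 <= gam -> gam < 1 ->
  continuous (fun z => mem_int gam (g z) t).
Proof.
move=> gam0 gam1.
suff main t' : 0 <= t' -> continuous (fun z => mem_int gam (g z) t').
  have -> : (fun z => mem_int gam (g z) t) = (fun z => mem_int gam (g z) (Num.max t 0)).
    by apply/funext => z; rewrite mem_int_max0.
  by apply: main; rewrite le_max lexx orbT.
move=> t0 z0; apply/(@cvgrPdist_le _ _ _ (nbhs z0)) => e e0.
pose kap := t' `^ (1 - gam) / (1 - gam).
have kap0 : 0 <= kap by rewrite divr_ge0 ?powR_ge0// subr_ge0 ltW.
have d0 : 0 < e / (kap + 1) by rewrite divr_gt0// ltr_wpDl.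
have h := @tube R _ _ (fun p => g p.1 p.2) _ z0 _ (@segment_compact R 0 t') (fun y _ => @cg (z0, y)) d0.
apply: filterS h => z hz /=.
rewrite distrC (mem_intB gam0 gam1)//; try exact: joint_continuous_time.
have := @mem_int_norm R gam gam0 gam1 (fun s => g z s - g z0 s) t' (e / (kap + 1)) _ t0 _.
move=> h2; apply: le_trans (h2 _ _) _.
- move=> s; apply: cvgB; exact: joint_continuous_time.
- by move=> s s0; apply/ltW/hz; rewrite /= in_itv.
- by rewrite -/kap mulrAC ler_pdivrMr ?ltr_wpDl// ler_pM2l// lerDl.
Qed.

(** With exponent 0 the kernel is identically 1, even at [s = t], so results on the memory integral
    cover the plain time integral. *)
Lemma Rint_mem_int (v : R -> R) t : Defs.Rint 0 t v = mem_int 0 v t.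
Proof.
rewrite /mem_int; apply: eq_Rintegral => s _.
by rewrite oppr0 powRr0 mul1r.
Qed.

Lemma Rint_continuous_space t : continuous (fun z => Defs.Rint 0 t (g z)).
Proof.
have -> : (fun z => Defs.Rint 0 t (g z)) = (fun z => mem_int 0 (g z) t).
  by apply/funext => z; exact: Rint_mem_int.
exact: mem_int_continuous_space.
Qed.

Variables (L : R) (psi : 'rV[R]_n -> R).
Hypotheses (L0 : 0 <= L) (Kpsi : CK L psi).

Lemma CK_bound : exists2 C, 0 < C & forall z, `|psi z| <= C.
Proof.
have [W W0 hW] := compact_bound (@compact_box R n L) Kpsi.1.
exists (W + 1); first by rewrite ltr_wpDl.
move=> z; have [zb|/not_box zb] := pselect (@box R n L z).
  by rewrite (le_trans (hW z zb))// lerDl.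
by rewrite Kpsi.2// normr0 addr_ge0.
Qed.

Lemma rVint_weight_continuous (m : 'rV[R]_n -> R -> R) (t0 : R) :
  (forall t, continuous (fun z => m z t)) ->
  (forall e : R, 0 < e -> \forall t \near t0, forall z, @box R n L z -> `|m z t - m z t0| <= e) ->
  {for t0, continuous (fun t => rVint (fun z => m z t * psi z))}.
Proof.
move=> cm h; have [C C0 hC] := CK_bound.
apply: (rVint_continuous L0) => [t|e e0]; first exact: CK_mul.
have d0 : 0 < e / C by rewrite divr_gt0.
apply: filterS (h _ d0) => t ht z; rewrite -mulrBl normrM.
have [zb|/not_box zb] := pselect (@box R n L z).
  by rewrite -[leRHS](divfK (lt0r_neq0 C0)) ler_pM//; exact: ht.
by rewrite Kpsi.2// normr0 mulr0 ltW.
Qed.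

Lemma rVint_joint_continuous : continuous (fun t => rVint (fun z => g z t * psi z)).
Proof.
move=> t0; apply: rVint_weight_continuous => [t|e e0]; first exact: joint_continuous_space.
by apply: filterS (near_time_box L t0 e0) => t ht z zb; exact/ltW/ht.
Qed.

Lemma rVint_mem_continuous (gam : R) : 0 <= gam -> gam < 1 ->
  continuous (fun t => rVint (fun z => mem_int gam (g z) t * psi z)).
Proof.
move=> gam0 gam1 t0; apply: rVint_weight_continuous => [t|e e0].
  exact: mem_int_continuous_space.
pose T := `|t0| + 1.
have T0 : 0 <= T by rewrite addr_ge0.
have t0T : t0 < T by rewrite (le_lt_trans (ler_norm t0))// ltrDl.
have cK := compact_setX (@compact_box R n L) (@segment_compact R 0 T).
have [W W0 hW] := compact_bound cK cg.
have h1 := kap_small gam1 t0 W0 e0.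
have h2 : \forall t \near t0, t < T by exact: lt_nbhsl.
near=> t => z zb.
have tT : t <= T by apply: ltW; near: t.
have hWz s : 0 <= s <= T -> `|g z s| <= W.
  by move=> s0; apply: (hW (z, s)); split => //=; rewrite in_itv.
have := mem_int_holder gam0 gam1 (@joint_continuous_time z) (ltW t0T) tT T0 W0 hWz.
by move/le_trans; apply; near: t.
Unshelve. all: by end_near. Qed.

Lemma Rint_increment (v : R -> R) (t t' d e : R) : continuous v -> 0 <= t -> 0 <= t' ->
  (forall s, `|s - t| <= `|t' - t| -> `|v s - d| <= e) ->
  `|Defs.Rint 0 t' v - Defs.Rint 0 t v - d * (t' - t)| <= e * `|t' - t|.
Proof.
move=> cv t0 t'0 hv.
have vi a b : mu.-integrable `[a, b] (EFin \o v).
  by apply: integrable_itv; exact: continuous_subspaceT.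
have main a b : a <= b -> (forall s, a <= s <= b -> `|v s - d| <= e) ->
    `|Defs.Rint a b v - d * (b - a)| <= e * (b - a).
  move=> ab h.
  have E : Defs.Rint a b v - d * (b - a) = Defs.Rint a b (fun s => v s - d).
    rewrite /Defs.Rint RintegralB//; last first.
      by apply: integrable_itv; exact/continuous_subspaceT/cst_continuous.
    rewrite Rintegral_cst//= lebesgue_measure_itv/= lte_fin; congr (_ - d * _).
    case: ltP => [_|ba]; first by [].
    by have -> : b = a by [apply/eqP; rewrite eq_le ba ab]; rewrite subrr.
  rewrite E; apply: Rint_bound => //.
  apply: integrable_itv; apply: continuous_subspaceT => s.
  by apply: cvgB; [exact: cv|exact: cvg_cst].
case: (leP t t') => tt'.
  rewrite (Rint_chasles t0 tt' (vi _ _)) (ger0_norm (_ : 0 <= t' - t)) ?subr_ge0//; apply: main => // s /andP[ts st'].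
  by apply: hv; rewrite !ger0_norm ?subr_ge0// lerD2r.
have t't := ltW tt'.
rewrite (_ : _ - _ = - (Defs.Rint t' t v - d * (t - t'))); last first.
  by rewrite -(Rint_chasles t'0 t't (vi _ _)); ring.
rewrite normrN (distrC t' t) (ger0_norm (_ : 0 <= t - t')) ?subr_ge0//.
apply: main => // s /andP[t's st].
by apply: hv; rewrite distrC (distrC t') !ger0_norm ?subr_ge0// lerD2l lerN2.
Qed.

(** [g z s] is close to [g z t] uniformly over the box when [s] is near [t]. The increment of the
    inner integral is therefore linear up to an error uniform in [z], and the bound on [rVint]
    carries this error outside without swapping integrals. *)
Lemma is_derive_time_integral (t : R) : 0 < t ->
  is_derive t 1 (fun t => rVint (fun z => Defs.Rint 0 t (g z) * psi z))
    (rVint (fun z => g z t * psi z)).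
Proof.
move=> t0; have [C C0 hC] := CK_bound.
have KJ s : CK L (fun z => Defs.Rint 0 s (g z) * psi z).
  by apply: CK_mul => //; exact: Rint_continuous_space.
have Kg : CK L (fun z => g z t * psi z).
  by apply: CK_mul => //; exact: joint_continuous_space.
apply: is_derive_littleo => e e0.
pose V := (2 * L) ^+ n.
have V0 : 0 <= V by rewrite exprn_ge0// mulr_ge0.
(* [C] will absorb the size of [psi], and [V + 1] the volume of the box. *)
have VC : 0 < (V + 1) * C by rewrite mulr_gt0// ltr_wpDl.
have d0 : 0 < e / ((V + 1) * C) by rewrite divr_gt0.
have /nbhs_ballP[r /= r0 hr] := near_time_box L t d0.
have h1 : \forall y \near t, `|y - t| < r.
  apply/nbhs_ballP; exists r => // y; rewrite /ball/= distrC; exact.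
have h2 : \forall y \near t, 0 < y by exact: lt_nbhsr.
near=> y; have yr : `|y - t| < r by near: y.
have y0 : 0 < y by near: y.
have Kd := CK_add (CK_add (KJ y) (CK_scale (-1) (KJ t))) (CK_scale (- (y - t)) Kg).
have -> : rVint (fun z => Defs.Rint 0 y (g z) * psi z) - rVint (fun z => Defs.Rint 0 t (g z) * psi z) -
    rVint (fun z => g z t * psi z) * (y - t) =
    rVint (fun z => Defs.Rint 0 y (g z) * psi z + -1 * (Defs.Rint 0 t (g z) * psi z) +
      - (y - t) * (g z t * psi z)).
  rewrite (rVintD L0) ?(rVintD L0) ?(rVintZ L0)//; try exact: CK_scale.
    by ring.
  exact: CK_add (KJ y) (CK_scale (-1) (KJ t)).
apply: le_trans (rVint_norm L0 (M := e / (V + 1) * `|y - t|) Kd _) _.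
  move=> z.
  have -> : Defs.Rint 0 y (g z) * psi z + -1 * (Defs.Rint 0 t (g z) * psi z) +
      - (y - t) * (g z t * psi z) =
      (Defs.Rint 0 y (g z) - Defs.Rint 0 t (g z) - g z t * (y - t)) * psi z by ring.
  have [zb|/not_box zb] := pselect (@box R n L z); last first.
    by rewrite Kpsi.2// mulr0 normr0 mulr_ge0// divr_ge0 ?ltW// ltr_wpDl.
  rewrite normrM.
  have := @Rint_increment (g z) t y (g z t) (e / ((V + 1) * C)) (@joint_continuous_time z)
    (ltW t0) (ltW y0).
  move=> /(_ _)/ler_pM h3.
  have -> : e / (V + 1) * `|y - t| = e / ((V + 1) * C) * `|y - t| * C.
    by field; rewrite !gt_eqF// ltr_wpDl.
  apply: h3 => // s st; apply/ltW/hr => //.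
  by rewrite /ball/= distrC (le_lt_trans st).
rewrite -/V mulrA ler_wpM2r// mulrCA ger_pMr// ler_pdivrMr ?ltr_wpDl//.
by rewrite mul1r lerDl.
Unshelve. all: by end_near. Qed.

End SpaceTime.

(** * From the weak formulation to the differential inequality *)

Section WeakToStrong.
Variable R : realType.

(* du Bois-Reymond: the test function [eta] is the primitive, vanishing at [T], of the defect
   [f - f0 - q], so that the weak identity becomes [Rint 0 T (f - f0 - q)^2 = 0]. *)
Lemma du_bois_reymond (f A q : R -> R) (f0 T : R) : 0 < T -> continuous f -> continuous A ->
  q 0 = 0 -> (forall t : R, is_derive t 1 q (A (Num.max t 0))) ->
  (forall eta deta : R -> R, (forall t : R, is_derive t 1 eta (deta t)) -> continuous deta ->
     eta T = 0 -> - (f0 * eta 0) = Defs.Rint 0 T (fun t => A t * eta t + f t * deta t)) ->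
  forall t, 0 < t < T -> f t = f0 + q t.
Proof.
move=> T0 cf cA q0 dq weak.
have cq : continuous q by move=> t; exact: is_derive_continuous (dq t).
pose D t := f t - f0 - q t.
have cD : continuous D.
  by move=> t; apply: cvgB; [apply: cvgB; [exact: cf|exact: cvg_cst]|exact: cq].
pose Dm (t : R) := D (Num.max t 0).
have cm (h : R -> R) : continuous h -> continuous (fun t : R => h (Num.max t 0)).
  move=> ch t; apply: (@continuous_comp _ _ _ (fun t : R => Num.max t 0) h).
    exact: continuous_max0.
  exact: ch.
have cDm : continuous Dm by exact: cm.
have [e0 _ de0] := primitive cD.
pose eta t := e0 t + - e0 T.
have deta (t : R) : is_derive t 1 eta (Dm t).
  by apply: is_derive_eq (is_derive_add (de0 t) (is_derive_const t (- e0 T))) _; rewrite addr0.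
have etaT : eta T = 0 by rewrite /eta subrr.
have W := weak eta Dm deta cDm etaT.
have ceta : continuous eta by move=> t; exact: is_derive_continuous (deta t).
(* On [[0, T]] the integrand of the weak identity is [dG + D ^+ 2], and [G T - G 0 = - (f0 * eta 0)]
   is its left side, so the integral of [D ^+ 2] must vanish. *)
pose G t := q t * eta t + f0 * eta t.
pose dG t := A (Num.max t 0) * eta t + q t * Dm t + f0 * Dm t.
have hG (t : R) : is_derive t 1 G (dG t).
  exact: is_derive_add (is_derive_mul (dq t) (deta t)) (is_derive_scale f0 (deta t)).
have cdG : continuous dG.
  move=> t; apply: cvgD; last by apply: cvgM; [exact: cvg_cst|exact: cDm].
  apply: cvgD; first by apply: cvgM; [exact: (cm _ cA)|exact: ceta].
  by apply: cvgM; [exact: cq|exact: cDm].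
have cD2 : continuous (fun t : R => D t ^+ 2) by move=> t; apply: cvgM; exact: cD.
have [P2 P20 dP2] := primitive cD2.
have I1 := Rint_FTC2 (ltW T0) hG cdG.
have I2 := Rint_FTC2 (ltW T0) dP2 (cm _ cD2).
have P2T : P2 T = 0.
  have : Defs.Rint 0 T (fun t => A t * eta t + f t * Dm t) =
      Defs.Rint 0 T dG + Defs.Rint 0 T (fun t => D (Num.max t 0) ^+ 2).
    rewrite /Defs.Rint -RintegralD//; last 2 first.
    - by apply: integrable_itv; exact: continuous_subspaceT.
    - by apply: integrable_itv; exact: continuous_subspaceT (cm _ cD2).
    apply: eq_Rintegral => t; rewrite inE/= in_itv/= => /andP[t0 _].
    by rewrite /dG /Dm max_l// /D; ring.
  by rewrite -W I1 I2 /G etaT q0 P20; lra.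
(* Being nondecreasing and zero at both 0 and [T], [P2] is zero in between, and so is its derivative
   [D ^+ 2]. *)
have P2mono a b : a <= b -> P2 a <= P2 b.
  move=> ab; apply: (derive_ge0_le ab (fun x _ => dP2 x)) => [x _|]; first exact: sqr_ge0.
  by apply: (is_derive_within (fun x _ => dP2 x)).
move=> t /andP[t0 tT].
have P2c : \forall s \near t, P2 s = (fun=> 0) s.
  near=> s.
  have s0 : 0 <= s by apply: ltW; near: s; exact: lt_nbhsr.
  have sT : s <= T by apply: ltW; near: s; exact: lt_nbhsl.
  apply/eqP; rewrite eq_le; apply/andP; split.
    by rewrite -[leRHS]P2T; exact: P2mono.
  by rewrite -[leLHS]P20; exact: P2mono.
have [_] := dP2 t; rewrite (near_eq_derive _ P2c) ?oner_neq0//.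
rewrite derive_cst max_l ?(ltW t0)// => /esym/eqP; rewrite sqrf_eq0 => /eqP.
rewrite /D; lra.
Unshelve. all: by end_near. Qed.

End WeakToStrong.

(** * Extension to all times and convexity *)

Section Reduction.
Variables (R : realType) (n : nat).
Local Notation mu := (@lebesgue_measure R).

Lemma coord_le_norm (z : 'rV[R]_n) i : `|z 0 i| <= `|z|.
Proof.
rewrite {2}/Num.norm/= mx_normrE.
exact: (le_bigmax _ (fun ij => `|z ij.1 ij.2|) (0, i)).
Qed.

(** [u] is arbitrary at negative times; clamping time at 0 gives a function continuous on all of
    space-time. Uniform continuity in time combines with continuity in space. *)
Lemma C_C0_joint (u : 'rV[R]_n -> R -> R) : C_C0 u ->
  continuous (fun p : 'rV[R]_n * R => u p.1 (Num.max p.2 0)).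
Proof.
move=> [h1 h2]; apply: (@joint_continuous R n (fun z t => u z (Num.max t 0))) => [t|t0 e e0].
  by have [] := h1 (Num.max t 0) ltac:(by rewrite le_max lexx orbT).
have m0 t : 0 <= Num.max t 0 :> R by rewrite le_max lexx orbT.
have [d [d0 hd]] := h2 (Num.max t0 0) e (m0 t0) e0.
have /cvgrPdist_lt/(_ d d0) := @continuous_max0 R t0.
by apply: filterS => t ht z; apply: hd => //; rewrite distrC.
Qed.

Variables (L : R) (psi : 'rV[R]_n -> R) (U w : 'rV[R]_n -> R -> R) (p : R).
Hypotheses (L0 : 0 <= L) (Kpsi : CK L psi) (psi0 : forall z, 0 <= psi z).
Hypothesis cU : continuous (fun q : 'rV[R]_n * R => U q.1 q.2).
Hypothesis cw : continuous (fun q : 'rV[R]_n * R => w q.1 q.2).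
Hypotheses (U0 : forall z t, 0 <= U z t) (wU : forall z t, w z t = U z t `^ p).
Hypothesis p1 : 1 < p.

(** The tangent inequality for the power is integrated against [psi] at the weighted mean
    [a = f / J], where the tangent integrates to exactly [a^p J]. The constant equals
    [J^(1 - p)]. *)
Lemma jensen t : 0 < rVint psi ->
  (rVint psi)^-1 `^ p * rVint psi * rVint (fun z => U z t * psi z) `^ p <=
  rVint (fun z => w z t * psi z).
Proof.
set J := rVint psi; set f := rVint _ => J0.
have f0 : 0 <= f by apply: rVint_ge0 => z; exact: mulr_ge0.
pose a := f / J; have a0 : 0 <= a by rewrite divr_ge0// ltW.
have KU : CK L (fun z => U z t * psi z) by apply: CK_mul => //; exact: joint_continuous_space.
have Kw : CK L (fun z => w z t * psi z) by apply: CK_mul => //; exact: joint_continuous_space.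
have : rVint (fun z => p * a `^ (p - 1) * (U z t * psi z) + - ((p - 1) * a `^ p) * psi z) <=
    rVint (fun z => w z t * psi z).
  apply: (le_rVint L0) => //; first by apply: CK_add; exact: CK_scale.
  move=> z; rewrite mulrA -mulrDl; apply: ler_wpM2r => //.
  by rewrite wU; apply: powR_tangent.
rewrite (rVintD L0) ?(rVintZ L0)//; try exact: CK_scale.
apply: le_trans; rewrite -/f -/J.
have fE : f = a * J by rewrite /a divfK// gt_eqF.
have -> : J^-1 `^ p * J * f `^ p = a `^ p * J.
  by rewrite /a powRM ?invr_ge0 ?(ltW J0)//; ring.
have -> : p * a `^ (p - 1) * f = p * (a `^ p) * J.
  by rewrite fE -(@mulr_powRB1 _ a p)//; [ring|exact: lt_trans ltr01 p1].
by rewrite le_eqVlt; apply/orP; left; apply/eqP; ring.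
Qed.

End Reduction.

Unset Implicit Arguments.

Theorem theorem3 (R : realType) (N k : nat) (gamma p : R)
    (u0 : 'rV[R]_(N + k) -> R) :
  (1 <= N)%N -> (1 <= k)%N ->
  0 <= gamma -> gamma < 1 -> 1 < p ->
  C0 u0 -> (forall z, 0 <= u0 z) -> (exists z, u0 z != 0) ->
  p * gamma <= 1 ->
  ~ (exists u : 'rV[R]_(N + k) -> R -> R,
       [/\ C_C0 u,
           (forall z t, 0 <= t -> 0 <= u z t) &
           global_weak_sol gamma p u0 u]).
Proof.
move=> N1 _ gam0 gam1 p1 [cu0 _] u0_ge0 [z1 u0z1] pg [u [Cu u_ge0 Wu]].
have p0 : 0 < p by lra.
(* Large enough for [psi] to be positive at [z1], where [u0] is, and at least 1 as [bump2_ge]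
   demands. *)
pose L := `|z1| + 1.
have L1 : 1 <= L by rewrite lerDr.
have L0 : 0 <= L by lra.
pose psi := @cutoff R (N + k) L.
have Kpsi : CK L psi by exact: CK_prod_bump.
have psi_ge0 z : 0 <= psi z by exact: cutoff_ge0.
have psi_gt0 : 0 < psi z1.
  by apply: cutoff_gt0 => i; rewrite (le_lt_trans (coord_le_norm z1 i))// ltrDl.
pose lam := 10 * N%:R + 10 * k%:R * (N%:R * L ^+ 2).
have lam0 : 0 < lam.
  by rewrite ltr_pwDl ?mulr_gt0 ?ltr0n// !mulr_ge0// exprn_ge0.
have m0 (t : R) : 0 <= Num.max t 0 by rewrite le_max lexx orbT.
pose U z t := u z (Num.max t 0).
have uU z t : 0 <= t -> u z t = U z t by move=> t0; rewrite /U max_l.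
have cU := C_C0_joint Cu; rewrite -/(U _ _) in cU.
have U0 z t : 0 <= U z t by exact: u_ge0.
pose w z t := `|U z t| `^ (p - 1) * U z t.
have cw : continuous (fun q : 'rV[R]_(N + k) * R => w q.1 q.2).
  move=> q; apply: cvgM; last exact: cU.
  apply: (@continuous_comp _ _ _ (fun q : 'rV[R]_(N + k) * R => U q.1 q.2)
    (fun x : R => `|x| `^ (p - 1))); first exact: cU.
  by apply: continuous_norm_powR; lra.
have wU z t : w z t = U z t `^ p by rewrite /w ger0_norm// mulrC mulr_powRB1.
have w0 z t : 0 <= w z t by rewrite wU powR_ge0.
have memE z t : memory gamma p u z t = mem_int gamma (w z) t.
  apply: eq_Rintegral => s; rewrite inE/= in_itv/= => /andP[s0 _].
  by rewrite uU.
pose f0 := rVint (fun z => u0 z * psi z).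
pose f t := rVint (fun z => U z t * psi z).
pose A t := rVint (fun z => mem_int gamma (w z) t * psi z).
pose B t := rVint (fun z => U z t * grushin_cutoff L z).
pose h t := rVint (fun z => w z t * psi z).
pose P t := rVint (fun z => Defs.Rint 0 t (w z) * psi z).
have KG : CK L (@grushin_cutoff R N k L) by exact: CK_grushin_cutoff.
have KU t : CK L (fun z => U z t * psi z).
  by apply: CK_mul => //; apply: (@joint_continuous_space R _ U).
have KUG t : CK L (fun z => U z t * grushin_cutoff L z).
  by apply: CK_mul => //; apply: (@joint_continuous_space R _ U).
have KM t : CK L (fun z => mem_int gamma (w z) t * psi z).
  by apply: CK_mul => //; exact: mem_int_continuous_space.
have cf : continuous f by apply: (@rVint_joint_continuous R _ U cU L).
have cA : continuous A by apply: (@rVint_mem_continuous R _ w cw L).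
have cB : continuous B by apply: (@rVint_joint_continuous R _ U cU L).
have cAB : continuous (fun t => A t + B t) by move=> t; apply: cvgD; [exact: cA|exact: cB].
have Ku0 : CK L (fun z => u0 z * psi z) by exact: CK_mul.
have f00 : 0 < f0.
  apply: (rVint_gt0 (z0 := z1) L0 Ku0) => [z|]; first by rewrite mulr_ge0.
  by rewrite mulr_gt0// lt_def u0z1 u0_ge0.
have J0 : 0 < rVint psi by exact: (rVint_gt0 (z0 := z1) L0 Kpsi).
have [q q0 dq] := primitive cAB.
have weak (T : R) (eta deta : R -> R) : 0 < T -> (forall t : R, is_derive t 1 eta (deta t)) ->
    continuous deta -> eta T = 0 ->
    - (f0 * eta 0) = Defs.Rint 0 T (fun t => (A t + B t) * eta t + f t * deta t).
  move=> T0 he cd eT.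
  have ce : continuous eta by move=> t; exact: is_derive_continuous (he t).
  (* Pulls the time factor of the test function out of each space integral. *)
  have ext (F : 'rV[R]_(N + k) -> R) c (F' : 'rV[R]_(N + k) -> R) : CK L F ->
      (forall z, F' z = F z * c) -> rVint F' = rVint F * c.
    move=> KF E; rewrite mulrC -(rVintZ L0)//; congr (@rVint R _ _).
    by apply/funext => z; rewrite E mulrC.
  have := Wu T T0 _ (@test_fun_cutoff R (N + k) L L1 T eta deta he cd eT).
  rewrite (ext (fun z => u0 z * psi z) (eta 0))//; last by move=> z; rewrite mulrA.
  move=> ->.
  have i1 : (@lebesgue_measure R).-integrable `[0, T]%classic (EFin \o (fun t => A t * eta t)).
    by apply: integrable_itv; apply: continuous_subspaceT => t; apply: cvgM; [exact: cA|exact: ce].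
  have i2 : (@lebesgue_measure R).-integrable `[0, T]%classic (EFin \o (fun t => B t * eta t)).
    by apply: integrable_itv; apply: continuous_subspaceT => t; apply: cvgM; [exact: cB|exact: ce].
  have i3 : (@lebesgue_measure R).-integrable `[0, T]%classic (EFin \o (fun t => f t * deta t)).
    by apply: integrable_itv; apply: continuous_subspaceT => t; apply: cvgM; [exact: cf|exact: cd].
  have i12 : (@lebesgue_measure R).-integrable `[0, T]%classic
      (EFin \o (fun t => A t * eta t + B t * eta t)).
    apply: integrable_itv; apply: continuous_subspaceT => t.
    by apply: cvgD; apply: cvgM; [exact: cA|exact: ce|exact: cB|exact: ce].
  have -> : Defs.Rint 0 T (fun t => (A t + B t) * eta t + f t * deta t) =
      Defs.Rint 0 T (fun t => A t * eta t) + Defs.Rint 0 T (fun t => B t * eta t) +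
      Defs.Rint 0 T (fun t => f t * deta t).
    rewrite /Defs.Rint -RintegralD// -RintegralD//.
    by apply: eq_Rintegral => t _; rewrite mulrDl.
  congr (_ + _ + _); apply: eq_Rintegral => t; rewrite inE/= in_itv/= => /andP[t0 _].
  - by apply: ext => // z; rewrite memE mulrA.
  - by apply: ext => // z; rewrite grushin_cutoffE uU// mulrA.
  - apply: ext => // z; rewrite uU// /dt derive1E.
    by have [_ ->] := is_derive_scale (cutoff L z) (he t); rewrite mulrA.
(* The identity is obtained only strictly inside the horizon, hence the horizon [t + 1]. *)
have fE t : 0 < t -> f t = f0 + q t.
  move=> t0; have T0 : 0 < t + 1 by lra.
  apply: (@du_bois_reymond R f _ q f0 (t + 1) T0 cf cAB q0 dq) => [eta deta|].
    exact: weak.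
  by rewrite t0 ltrDl ltr01.
(* [F] replaces [f] because it is differentiable at every time and its value at 0 is visibly [f0],
   the integral of the initial datum; the two agree at positive times. *)
pose F t := f0 + q t.
have dF (t : R) : is_derive t 1 F (A (Num.max t 0) + B (Num.max t 0)).
  apply: is_derive_eq (is_derive_add (is_derive_const t f0) (dq t)) _; exact: add0r.
apply: (@no_global_ode R lam ((rVint psi)^-1 `^ p * rVint psi) gamma p F P
  (fun t => A (Num.max t 0) + B (Num.max t 0)) h) => //.
- by rewrite mulr_gt0// powR_gt0// invr_gt0.
- exact: is_derive_continuous (dF 0).
- by rewrite /F q0 addr0.
- move=> t t0; apply: rVint_ge0 => z; rewrite mulr_ge0//.
  by apply: Rintegral_ge0 => s _; exact: w0.
- by move=> t t0; apply: (@is_derive_time_integral R _ w cw L).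
(* The memory part [A] gives the source through [mem_int_ge], the diffusion part [B] the damping
   through [grushin_cutoff_ge]. *)
- move=> t t0; rewrite max_l ?(ltW t0)// addrC lerD//.
    rewrite -(rVintZ L0); last by apply: CK_mul => //; exact: Rint_continuous_space.
    apply: (le_rVint L0) => //.
      by apply: CK_scale; apply: CK_mul => //; exact: Rint_continuous_space.
    move=> z; rewrite mulrA; apply: ler_wpM2r => //.
    by apply: mem_int_ge => //; exact: (@joint_continuous_time R _ w).
  rewrite /F -fE// -(rVintZ L0)//; apply: (le_rVint L0) => //; first exact: CK_scale.
  by move=> z; rewrite mulrCA; apply: ler_wpM2l => //; exact: grushin_cutoff_ge.
- move=> t t0; by rewrite /F -fE//; apply: (@jensen R _ L).
Qed.
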